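(* For each $n$ let $\Pi_n$ be the Ewens-Pitman random partition of $[n]$ with parameters $(\alpha,\theta)$ and smallest block size $|A_{(|\Pi_n|)}|$. Let $0<x<1$ and let $r=r(n)$ be integers with $r\sim xn$ as $n\to\infty$. (i) If $0<\alpha<1$ and $\theta>-\alpha$, then $$\mathbb{P}(|A_{(|\Pi_n|)}|\ge r)\sim\frac{\Gamma(1+\theta)}{\Gamma(1-\alpha)}n^{-\theta-\alpha},\qquad n,r\to\infty,\ r\sim xn.$$ (ii) If $\alpha<0$ and $\theta=-m\alpha$ with $m\in\{1,2,\dots\}$, then $$\mathbb{P}(|A_{(|\Pi_n|)}|\ge r)\sim\mathcal{I}_{x,x}^{(m-1)}(-\alpha;-\alpha)\qquad\text{if } x^{-1}\ge m,$$ and $\mathbb{P}(|A_{(|\Pi_n|)}|\ge r)=O\big(n^{(m-\lfloor x^{-1}\rfloor)\alpha}\big)$ if $x^{-1}<m$.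
   Context: $[n]=\{1,\dots,n\}$. For a random partition $\Pi_n$ of $[n]$ (into nonempty disjoint blocks), $|\Pi_n|$ is the number of blocks and $|A_{(1)}|\ge\cdots\ge|A_{(|\Pi_n|)}|$ are the block sizes in descending order, so $|A_{(|\Pi_n|)}|$ is the smallest block size. Write $(x)_{i;a}=x(x+a)\cdots(x+(i-1)a)$, $(x)_{0;a}=1$, and $(x)_i=(x)_{i;1}$. The Ewens-Pitman partition with parameters $(\alpha,\theta)$ (either $0\le\alpha<1$, $\theta>-\alpha$, or $\alpha<0$, $\theta=-m\alpha$, $m=1,2,\dots$) is the exchangeable random partition of $[n]$ in which a given partition with blocks of sizes $n_1,\dots,n_k$ has probability $\frac{(\theta)_{k;\alpha}}{(\theta)_n}\prod_{j=1}^k(1-\alpha)_{n_j-1}$; when $\theta=0$ the ratio $(\theta)_{k;\alpha}/(\theta)_n$ is read as $(\theta+\alpha)_{k-1;\alpha}/(\theta+1)_{n-1}$. Incomplete Dirichlet integrals: for nonzero real $\nu,\rho$ and integer $b\ge1$, $$\mathcal{I}_{p,q}^{(b)}(\nu;\rho)=\frac{\Gamma(\rho+b\nu)}{\Gamma(\rho)\Gamma(\nu)^b}\int_{\Delta_b(p,q)}y_{b+1}^{\rho-1}\prod_{j=1}^b y_j^{\nu-1}\,dy_j,\qquad y_{b+1}=1-\sum_{j=1}^b y_j,$$ with $\Delta_b(p,q)=\{(y_1,\dots,y_b): y_i>p\ (1\le i\le b),\ \sum_{j=1}^b y_j<1-q\}$, and $\mathcal{I}^{(0)}_{p,q}(\nu;\rho)=1$.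 If $\Delta_b(p,q)$ is empty the integral is $0$. The symbol $a_n\sim b_n$ means $a_n/b_n\to1$; when the right-hand side is a constant not depending on $n$, it means convergence to this constant (which may be $0$). *)

(* Defs.v *)
From HB Require Import structures.
From mathcomp Require Import all_boot all_order all_algebra.
From mathcomp Require Import all_classical all_reals all_analysis.
Import Order.TTheory GRing.Theory Num.Theory.
Import numFieldNormedType.Exports.

Set Implicit Arguments.
Unset Strict Implicit.
Unset Printing Implicit Defensive.

Local Open Scope ring_scope.

(* (x)_{i;a} = x (x + a) ... (x + (i - 1) a) *)
Definition rising {R : realType} (x a : R) (i : nat) : R :=
  \prod_(j < i) (x + j%:R * a).

(* Sizes of the blocks, with multiplicities, in descending order. *)
Definition block_sizes {n : nat} (pi : {set {set 'I_n}}) : seq nat :=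
  sort geq [seq #|B| | B : {set 'I_n} in pi].

Definition smallest_block {n : nat} (pi : {set {set 'I_n}}) : nat :=
  last 0%N (block_sizes pi).

(* The set [n] is represented by 'I_n. When theta = 0 a factor theta cancels
   in the ratio (theta)_{k;alpha} / (theta)_n. *)
Definition ewens_pitman_pmf {R : realType} (alpha theta : R) {n : nat}
    (pi : {set {set 'I_n}}) : R :=
  (if theta == 0
   then rising (theta + alpha) alpha #|pi|.-1 / rising (theta + 1) 1 n.-1
   else rising theta alpha #|pi| / rising theta 1 n)
  * \prod_(B in pi) rising (1 - alpha) 1 #|B|.-1.

Definition is_ewens_pitman {R : realType} {d : measure_display}
    {T : measurableType d} (P : probability T R) (alpha theta : R) {n : nat}
    (Pi : T -> {set {set 'I_n}}) : Prop :=
  [/\ forall t, finset.partition (Pi t) [set: 'I_n]%SET,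
      forall pi, measurable [set t | Pi t = pi]%classic
    & forall pi, finset.partition pi [set: 'I_n]%SET ->
        P [set t | Pi t = pi]%classic = (ewens_pitman_pmf alpha theta pi)%:E].

Definition Gamma_integral {R : realType} (a : R) : R :=
  fine (\int[lebesgue_measure]_(t in `]0%R, +oo[)
          (t `^ (a - 1) * expR (- t))%:E)%E.

(* Euler's integral for x > 0, extended to x <= 0 by Gamma (x + 1) = x Gamma x.
   At the poles 0, -1, -2, ... the denominator vanishes and the value is 0, so
   that (Gamma x)^-1 is 0 there, as it should be. *)
Definition Gamma {R : realType} (x : R) : R :=
  let k := if 0 < x then 0%N else (Num.truncn (- x)).+1 in
  Gamma_integral (x + k%:R) / rising x 1 k.

(* Integral of f over R^b as an iterated Lebesgue integral; by Tonelli it is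
   the integral for the b-dimensional Lebesgue measure when f is nonnegative
   and measurable, which is the only case used. *)
Fixpoint integral_Rn {R : realType} (b : nat) (f : seq R -> \bar R) : \bar R :=
  if b is b'.+1 then
    (\int[lebesgue_measure]_y integral_Rn b' (fun s => f (y :: s)))%E
  else f [::].

Definition in_Delta {R : realType} (p q : R) (s : seq R) : bool :=
  all (fun y => p < y) s && (\sum_(y <- s) y < 1 - q).

Definition dirichlet_integrand {R : realType} (p q nu rho : R) (s : seq R) : R :=
  if in_Delta p q s
  then (1 - \sum_(y <- s) y) `^ (rho - 1) * \prod_(y <- s) y `^ (nu - 1)
  else 0.

Definition incomplete_dirichlet {R : realType} (p q : R) (b : nat)
    (nu rho : R) : R :=
  if b is 0%N then 1 else
  Gamma (rho + b%:R * nu) / (Gamma rho * Gamma nu ^+ b)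
  * fine (integral_Rn b (fun s => (dirichlet_integrand p q nu rho s)%:E)).

Definition asymp_equiv {R : realType} (a b : nat -> R) : Prop :=
  ((fun n => a n / b n) @ \oo --> (1 : R))%classic.

(* Main.v *)
Require Import Defs.
From HB Require Import structures.
From mathcomp Require Import all_boot all_order all_algebra.
From mathcomp Require Import all_classical all_reals all_analysis.
From mathcomp Require Import measurable_realfun zify ring lra.
Import Order.TTheory GRing.Theory Num.Theory.
Import numFieldNormedType.Exports.
Local Open Scope classical_set_scope.
Local Open Scope ring_scope.

(** Marking a block of a partition shows that the exponential generating
    function of the partitions with k blocks is, up to k!, a k-th power; hence
    P(|A_(|Pi_n|)| >= r) is the sum over k of
    (theta + alpha)_(k-1;alpha) / k! * n! / (theta + 1)_(n-1) * w^{*k}(n),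
    where w(i) = (1 - alpha)_(i-1) / i! for i >= r, and 0 otherwise.  Gauss's
    formula gives w(i) ~ i^(-alpha-1) / Gamma(1 - alpha) uniformly for i of
    order n, and n^(1 + k alpha) w^{*k}(n) converges to
    Gamma(1 - alpha)^(-k) times the k-fold convolution of
    y^(-alpha-1) 1_(y > x) at 1, by induction on k with dominated convergence
    in one variable.  The k-th term is thus of order n^(-theta - k alpha), and
    it vanishes when k r > n, so that only k <= 1/x matter: k = 1 dominates
    for alpha > 0, and the largest k dominates for alpha < 0.  For
    theta = -m alpha the terms with k > m are 0, and the term k = m gives the
    Dirichlet integral. *)

(** * Gamma function *)

Definition gamma_density {R : realType} (a t : R) : R := t `^ (a - 1) * expR (- t).

Lemma gamma_density_ge0 {R : realType} (a t : R) : 0 <= gamma_density a t.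
Proof. by rewrite mulr_ge0 ?powR_ge0 ?expR_ge0. Qed.

Lemma measurable_gamma_density {R : realType} (a : R) (D : set R) :
  measurable_fun D (gamma_density a).
Proof.
apply: measurable_funTS; apply: measurable_funM; first exact: measurable_powR.
by apply: measurableT_comp => //; exact: oppr_measurable.
Qed.

(** Integration by parts in differential form: integrated over a segment, it gives the functional
    equation of Gamma up to boundary terms. *)
Lemma is_derive_gamma_density {R : realType} (a t : R) : 0 < t ->
  is_derive t 1 (fun t => - gamma_density (a + 1) t)
    (gamma_density (a + 1) t - a * gamma_density a t).
Proof.
move=> t0; rewrite /gamma_density addrK.
have h1 := @is_derive1_powR R a t t0.
apply: is_derive_eq.
by rewrite /GRing.scale /=; ring.
Qed.

Lemma derivable_gamma_density {R : realType} (a t : R) : 0 < t ->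
  derivable (gamma_density a) t 1.
Proof.
move=> t0; have [h _] := is_derive_gamma_density (a - 1) t t0.
have -> : gamma_density a = - (fun t => - gamma_density (a - 1 + 1) t).
  by apply/funext => s; rewrite /= opprfctE opprK subrK.
exact: derivableN.
Qed.

Lemma continuous_gamma_density {R : realType} (a u v : R) : 0 < u ->
  {within `[u, v], continuous (gamma_density a)}.
Proof.
move=> u0; apply: derivable_within_continuous => t; rewrite in_itv/= => /andP[ut _].
exact/derivable_gamma_density/(lt_le_trans u0).
Qed.

Lemma integrable_gamma_density {R : realType} (a u v : R) : 0 < u ->
  lebesgue_measure.-integrable `[u, v] (EFin \o gamma_density a).
Proof.
move=> u0; apply: continuous_compact_integrable; first exact: segment_compact.
exact: continuous_gamma_density.
Qed.

(** The segment stays away from 0, where the density is singular for [a < 1], so that the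
    fundamental theorem of calculus applies. *)
Lemma integral_gamma_density_itv {R : realType} (a u v : R) : 0 < a -> 0 < u -> u < v ->
  (\int[lebesgue_measure]_(t in `[u, v]) (gamma_density (a + 1) t)%:E =
   a%:E * \int[lebesgue_measure]_(t in `[u, v]) (gamma_density a t)%:E
   + (gamma_density (a + 1) u - gamma_density (a + 1) v)%:E)%E.
Proof.
move=> a0 u0 uv.
have mu1 b := integrable_gamma_density b u v u0.
have -> : (gamma_density (a + 1) u - gamma_density (a + 1) v)%:E =
  (\int[lebesgue_measure]_(t in `[u, v])
    (gamma_density (a + 1) t - a * gamma_density a t)%:E)%E.
  rewrite (@continuous_FTC2 _ _ (fun t => - gamma_density (a + 1) t))//.
  - by rewrite -EFinB opprK addrC.
  - apply: derivable_within_continuous => t; rewrite in_itv/= => /andP[ut _].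
    have t0 := lt_le_trans u0 ut.
    apply: derivableB; first exact: derivable_gamma_density.
    by apply: derivableM; [exact: derivable_cst|exact: derivable_gamma_density].
  - have c : {within `[u, v], continuous (fun t => - gamma_density (a + 1) t)}.
      apply: derivable_within_continuous => t; rewrite in_itv/= => /andP[ut _].
      by have [] := is_derive_gamma_density a t (lt_le_trans u0 ut).
    move/continuous_within_itvP : c => /(_ uv)[_ cu cv].
    split => // t; rewrite in_itv/= => /andP[ut _].
    by have [] := is_derive_gamma_density a t (lt_trans u0 ut).
  - move=> t; rewrite in_itv/= => /andP[ut _]; rewrite derive1E.
    by have [_] := is_derive_gamma_density a t (lt_trans u0 ut).
under [X in (_ + X)%E]eq_integral do rewrite EFinB [(a * _)%:E]EFinM.
rewrite integralB//; last 2 first.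
- exact: mu1.
- exact: (integrableZl _ _ (mu1 a)).
rewrite integralZl//; last exact: mu1.
rewrite [RHS]addeC subeK//.
by rewrite fin_numM//; exact: (integrable_fin_num _ (mu1 a)).
Qed.

(** The segments [1/(n+2), n+2] exhaust the half-line; the shift by 2 keeps their endpoints
    distinct. *)
Lemma cvg_gamma_density_itv {R : realType} (a : R) :
  (\int[lebesgue_measure]_(t in `[(n.+2%:R^-1)%R, n.+2%:R%R]) (gamma_density a t)%:E)%E
    @[n --> \oo] -->
  (\int[lebesgue_measure]_(t in `]0%R, +oo[) (gamma_density a t)%:E)%E.
Proof.
have -> : `]0%R, +oo[%classic = \bigcup_n `[(n.+2%:R : R)^-1, n.+2%:R]%classic.
  apply/seteqP; split => t /=; rewrite in_itv/= ?andbT.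
    move=> t0; exists (maxn (Num.truncn t) (Num.truncn t^-1)) => //=.
    rewrite in_itv/=; apply/andP; split.
      rewrite -[leRHS]invrK lef_pV2 ?posrE ?invr_gt0//.
      apply/ltW/(lt_le_trans (truncnS_gt _)).
      by rewrite ler_nat ltnS ltnW// ltnS leq_maxr.
    apply/ltW/(lt_le_trans (truncnS_gt _)).
    by rewrite ler_nat ltnS ltnW// ltnS leq_maxl.
  by case=> n _ /=; rewrite in_itv/= => /andP[+ _]; apply: lt_le_trans; rewrite invr_gt0.
apply: ge0_nondecreasing_set_cvg_integral => //.
- move=> m n mn; rewrite subsetEset => t /=; rewrite !in_itv/= => /andP[h1 h2].
  apply/andP; split; last by rewrite (le_trans h2)// ler_nat !ltnS.
  by apply: le_trans h1; rewrite lef_pV2 ?posrE// ler_nat !ltnS.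
- by move=> n; apply/measurable_EFinP; exact: measurable_gamma_density.
- by move=> n t _; rewrite lee_fin gamma_density_ge0.
Qed.

Lemma cvg_inv_natSS {R : realType} : (n.+2%:R^-1 : R) @[n --> \oo] --> 0.
Proof.
by have := @cvg_harmonic R; rewrite -cvg_shiftS.
Qed.

Lemma gamma_density_cvg0r {R : realType} (a : R) : 0 < a ->
  gamma_density (a + 1) (n.+2%:R)^-1 @[n --> \oo] --> 0.
Proof.
move=> a0; apply/cvgrPdist_le => e e0; near=> n.
rewrite sub0r normrN ger0_norm ?mulr_ge0 ?powR_ge0 ?expR_ge0// /gamma_density addrK.
rewrite (@le_trans _ _ ((n.+2%:R^-1) `^ a))//.
  by rewrite ler_piMr ?powR_ge0// expR_le1 oppr_le0 invr_ge0.
(* Writing e as a power with exponent a reduces the bound to monotonicity of t^a. *)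
have -> : e = (e `^ a^-1) `^ a by rewrite -powRrM mulVf ?gt_eqF// powRr1 ?ltW.
rewrite ge0_ler_powR ?nnegrE ?(ltW a0) ?powR_ge0 ?invr_ge0//.
near: n; have h := @cvg_inv_natSS R.
have := @cvgr0_norm_le _ _ _ _ _ _ h (e `^ a^-1); rewrite powR_gt0// => /(_ _ isT).
apply: filterS => n; rewrite ger0_norm.
Unshelve. all: by end_near. Qed.

Lemma gamma_density_cvgy {R : realType} (a : R) : 0 < a ->
  gamma_density (a + 1) n.+2%:R @[n --> \oo] --> 0.
Proof.
move=> a0.
apply: (@squeeze_cvgr _ _ _ _ (fun=> 0) (fun n => (a + a) `^ a * 2 * n.+2%:R^-1)).
- apply: nearW => n; rewrite mulr_ge0 ?powR_ge0 ?expR_ge0//= /gamma_density addrK.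
  set t : R := n.+2%:R; have t0 : 0 < t by [].
  have aa : 0 < a + a by rewrite addr_gt0.
  (* The inequality u <= exp u at u = t / (2a), raised to the power a. Half of the exponential decay
     is left over, and a second use of u <= exp u bounds it by 2/t. *)
  have h1 : t `^ a <= (a + a) `^ a * expR (t / 2).
    have -> : expR (t / 2) = expR (t / (a + a)) `^ a.
      by rewrite /powR gt_eqF ?expR_gt0// expRK; congr expR; field; rewrite gt_eqF.
    rewrite -powRM ?expR_ge0 ?(ltW aa)// ge0_ler_powR ?nnegrE ?mulr_ge0
      ?expR_ge0 ?(ltW aa) ?(ltW a0)//.
    rewrite mulrC -ler_pdivrMr//; apply: le_trans (expR_ge1Dx _); rewrite lerDr//.
  rewrite (@le_trans _ _ ((a + a) `^ a * expR (t / 2) * expR (- t)))//.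
    by rewrite ler_wpM2r ?expR_ge0.
  rewrite -!mulrA -expRD ler_wpM2l ?powR_ge0//.
  have -> : t / 2 - t = - (t / 2) by field.
  rewrite expRN -[leRHS]invrK invfM invrK lef_pV2 ?posrE ?expR_gt0 ?mulr_gt0//.
  by rewrite mulrC; apply: le_trans (expR_ge1Dx _); rewrite lerDr.
- exact: cvg_cst.
- rewrite -[X in _ --> X](mulr0 ((a + a) `^ a * 2)).
  by apply: cvgM; [exact: cvg_cst|exact: cvg_inv_natSS].
Qed.

(** Kept in the extended reals so that the functional equation and the interpolation inequality can
    be proved before finiteness, which follows from them. *)
Definition gamma_eint {R : realType} (a : R) : \bar R :=
  (\int[lebesgue_measure]_(t in `]0%R, +oo[) (gamma_density a t)%:E)%E.

Lemma gamma_eint_ge0 {R : realType} (a : R) : (0 <= gamma_eint a)%E.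
Proof. by apply: integral_ge0 => t _; rewrite lee_fin gamma_density_ge0. Qed.

Lemma gamma_eintS {R : realType} (a : R) : 0 < a ->
  gamma_eint (a + 1) = (a%:E * gamma_eint a)%E.
Proof.
move=> a0.
have h1 := cvg_gamma_density_itv (a + 1).
suff h2 : (\int[lebesgue_measure]_(t in `[(n.+2%:R^-1)%R, n.+2%:R%R])
    (gamma_density (a + 1) t)%:E)%E @[n --> \oo] --> (a%:E * gamma_eint a)%E.
  exact: (cvg_unique _ h1 h2).
rewrite -[X in _ --> X]adde0.
under eq_cvg => n.
  rewrite integral_gamma_density_itv ?invr_gt0//; last first.
    by rewrite (@lt_trans _ _ 1)// ?invf_lt1// ltr1n.
  over.
apply: cvgeD.
- by rewrite fin_num_adde_defl.
- apply: cvgeZl => //; exact: cvg_gamma_density_itv.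
- apply: cvg_EFin; first exact: nearW.
  rewrite -[X in _ --> X](subrr 0).
  by apply: cvgB; [exact: gamma_density_cvg0r|exact: gamma_density_cvgy].
Qed.

(** Convexity of exp between ln (t/y) and 0, with weight s, gives (t/y)^s <= s (t/y) + 1 - s. *)
Lemma powR_le_tangent {R : realType} (y s t : R) : 0 < y -> 0 <= s <= 1 -> 0 < t ->
  t `^ s <= (1 - s) * y `^ s + s * y `^ (s - 1) * t.
Proof.
move=> y0 /andP[s0 s1] t0.
have := @convex_expR R (Itv01 s0 s1) (ln (t / y)) 0.
rewrite !convRE/= expR0 mulr1 /unstable.onem mulr0 addr0 lnK ?posrE ?divr_gt0//.
rewrite -ln_powR lnK ?posrE ?powR_gt0 ?divr_gt0// => h.
have -> : t `^ s = y `^ s * (t / y) `^ s.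
  by rewrite -powRM ?divr_ge0 ?ltW// mulrC divfK ?gt_eqF.
rewrite (le_trans (ler_wpM2l (powR_ge0 _ _) h))//.
rewrite powRB; last by rewrite (gt_eqF y0) implybT.
rewrite powRr1 ?(ltW y0)// le_eqVlt; apply/orP; left; apply/eqP; field; by rewrite (gt_eqF y0).
Qed.

Lemma gamma_density_interp {R : realType} (y s t : R) : 0 < y -> 0 <= s <= 1 -> 0 < t ->
  gamma_density (y + s) t <=
  (1 - s) * y `^ s * gamma_density y t + s * y `^ (s - 1) * gamma_density (y + 1) t.
Proof.
move=> y0 s01 t0; rewrite /gamma_density !mulrA -mulrDl ler_wpM2r ?expR_ge0//.
have tn (b c : R) : t `^ (b + c) = t `^ b * t `^ c.
  by rewrite powRD// (gt_eqF t0) implybT.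
have -> : t `^ (y + s - 1) = t `^ (y - 1) * t `^ s by rewrite -tn; congr powR; ring.
have -> : t `^ (y + 1 - 1) = t `^ (y - 1) * t.
  by rewrite -{3}(powRr1 (ltW t0)) -tn; congr powR; ring.
apply: le_trans (ler_wpM2l (powR_ge0 _ _) (powR_le_tangent _ _ _ y0 s01 t0)) _.
by rewrite le_eqVlt; apply/orP; left; apply/eqP; ring.
Qed.

(** The tangent is taken at t = y, the parameter itself, so that the right-hand side collapses to
    y^s Gamma(y) once Gamma(y + 1) = y Gamma(y) is inserted. *)
Lemma gamma_eint_interp {R : realType} (y s : R) : 0 < y -> 0 <= s <= 1 ->
  (gamma_eint (y + s) <=
  (((1 - s) * y `^ s)%:E * gamma_eint y + (s * y `^ (s - 1))%:E * gamma_eint (y + 1)))%E.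
Proof.
move=> y0 s01; have s0 : 0 <= s by case/andP: s01.
have s1 : 0 <= 1 - s by rewrite subr_ge0; case/andP: s01.
have mg (b c : R) : measurable_fun (`]0, +oo[%classic : set R)
    (fun t => c%:E * (gamma_density b t)%:E)%E.
  by apply: measurable_funeM; apply/measurable_EFinP; exact: measurable_gamma_density.
have mg' (b : R) : measurable_fun (`]0, +oo[%classic : set R) (fun t => (gamma_density b t)%:E)%E.
  by apply/measurable_EFinP; exact: measurable_gamma_density.
have p0 b : 0 <= y `^ b := powR_ge0 _ _.
have mul0 (b c t : R) : 0 <= c -> (0 <= c%:E * (gamma_density b t)%:E)%E.
  by move=> c0; rewrite -EFinM lee_fin mulr_ge0// gamma_density_ge0.
have intZ (b c : R) : 0 <= c -> (c%:E * gamma_eint b =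
    \int[lebesgue_measure]_(t in `]0%R, +oo[) (c%:E * (gamma_density b t)%:E))%E.
  move=> c0; rewrite ge0_integralZl//; first exact: mg'.
  by move=> t _; rewrite lee_fin gamma_density_ge0.
rewrite !intZ ?mulr_ge0// -ge0_integralD//; last 4 first.
- by move=> t _; apply: mul0; rewrite mulr_ge0.
- exact: mg.
- by move=> t _; apply: mul0; rewrite mulr_ge0.
- exact: mg.
apply: ge0_le_integral => //.
- by move=> t _; rewrite lee_fin gamma_density_ge0.
- exact: mg'.
- by apply: emeasurable_funD; exact: mg.
- move=> t /=; rewrite in_itv/= andbT => t0.
  by rewrite -!EFinM -EFinD lee_fin; exact: gamma_density_interp.
Qed.

(** For a = 1 the density is that of the exponential law of rate 1, whose total mass is 1. *)
Lemma gamma_eint1 {R : realType} : gamma_eint 1 = 1%E :> \bar R.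
Proof.
rewrite -(integral_exponential_pdf (@ltr01 R)) /gamma_eint integral_itv_obnd_cbnd; last first.
  by apply/measurable_EFinP; exact: measurable_gamma_density.
rewrite [LHS]integral_mkcond; apply: eq_integral => t _.
rewrite /exponential_pdf !patchE; case: ifP => // _.
by rewrite /gamma_density subrr powRr0 !mul1r mulN1r.
Qed.

(** Induction on an integer bound for a. For a <= 1, interpolation bounds the value at 1 + a by
    those at 1 and 2, and the functional equation read backwards gives finiteness at a; a larger a
    is lowered by 1. *)
Lemma gamma_eint_lty {R : realType} (a : R) : 0 < a -> (gamma_eint a < +oo)%E.
Proof.
move=> a0.
have [k] : exists k : nat, a <= k.+1%:R.
  by exists (Num.truncn a); exact/ltW/truncnS_gt.
elim: k a a0 => [a a0 a1|k IH a a0 ak].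
  have : (gamma_eint (1 + a) < +oo)%E.
    apply: (le_lt_trans (@gamma_eint_interp R 1 a ltr01 _)).
      by rewrite (ltW a0) a1.
    by rewrite gamma_eintS// gamma_eint1 !mule1 -EFinD ltry.
  rewrite addrC gamma_eintS//.
  case: (gamma_eint a) => [r _||] //; first exact: ltry.
  by rewrite mulry gtr0_sg// mul1e ltxx.
have [a1|a1] := leP a 1; first by apply: IH => //; rewrite (le_trans a1)// ler1n.
rewrite -(subrK 1 a) gamma_eintS ?subr_gt0//.
have := IH (a - 1); rewrite subr_gt0 lerBlDr natr1 => /(_ a1 ak).
have := gamma_eint_ge0 (a - 1).
by case: (gamma_eint (a - 1)) => [r _ _||] //; rewrite -EFinM ltry.
Qed.

Lemma gamma_eint_fin_num {R : realType} (a : R) : 0 < a -> gamma_eint a \is a fin_num.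
Proof. by move=> a0; rewrite ge0_fin_numE ?gamma_eint_ge0// gamma_eint_lty. Qed.

Lemma gamma_eint_gt0 {R : realType} (a : R) : 0 < a -> (0 < gamma_eint a)%E.
Proof.
(* A lower bound of the density on [1, 2]: the power is at least 1 if a >= 1 and at least 2^(a-1) if
   a < 1. *)
move=> a0; set c : R := Num.min 1 (2 `^ (a - 1)) * expR (- 2).
have c0 : 0 < c by rewrite mulr_gt0 ?expR_gt0// lt_min ltr01 powR_gt0.
apply: (@lt_le_trans _ _ (\int[lebesgue_measure]_(t in `[1%R, 2%R]) cst c%:E t)%E).
  rewrite integral_cst//= lebesgue_measure_itv/= lte_fin ltr1n -EFinB -EFinM lte_fin.
  by rewrite mulr_gt0// subr_gt0 ltr1n.
apply: (@le_trans _ _ (\int[lebesgue_measure]_(t in `[1%R, 2%R]) (gamma_density a t)%:E)%E).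
  apply: ge0_le_integral => //=.
  - by move=> t _; rewrite lee_fin ltW.
  - by apply/measurable_EFinP; exact: measurable_gamma_density.
  - move=> t; rewrite in_itv/= => /andP[t1 t2]; rewrite lee_fin.
    apply: ler_pM; rewrite ?le_min ?ler01 ?powR_ge0 ?expR_ge0// ?ler_expR ?lerN2//.
    rewrite ge_min; have [a1|a1] := leP 1 a.
      by have := @ler_powR _ t t1 0 (a - 1); rewrite powRr0 subr_ge0 => ->.
    apply/orP; right; rewrite -[a - 1]opprB !powRN lef_pV2 ?posrE ?powR_gt0 ?(lt_le_trans _ t1)//.
    by rewrite ge0_ler_powR ?nnegrE ?subr_ge0 ?(ltW a1)// (le_trans _ t1).
apply: ge0_subset_integral => //.
- by apply/measurable_EFinP; exact: measurable_gamma_density.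
- by move=> t _; rewrite lee_fin gamma_density_ge0.
- by move=> t /=; rewrite !in_itv/= andbT => /andP[t1 _]; exact: lt_le_trans t1.
Qed.

Lemma GammaE {R : realType} (a : R) : 0 < a -> Gamma a = fine (gamma_eint a).
Proof. by move=> a0; rewrite /Gamma a0 /rising big_ord0 divr1 addr0. Qed.

Lemma Gamma_gt0 {R : realType} (a : R) : 0 < a -> 0 < Gamma a.
Proof. by move=> a0; rewrite GammaE// fine_gt0// gamma_eint_gt0//= gamma_eint_lty. Qed.

Lemma GammaD1 {R : realType} (a : R) : 0 < a -> Gamma (a + 1) = a * Gamma a.
Proof. by move=> a0; rewrite !GammaE ?addr_gt0// gamma_eintS// fineM// gamma_eint_fin_num. Qed.

Lemma Gamma1 {R : realType} : Gamma 1 = 1 :> R.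
Proof. by rewrite GammaE// gamma_eint1. Qed.

Lemma rising_Gamma {R : realType} (a : R) (n : nat) : 0 < a ->
  Gamma (a + n%:R) = rising a 1 n * Gamma a.
Proof.
move=> a0; elim: n => [|n IH]; first by rewrite /rising big_ord0 addr0 mul1r.
rewrite -natr1 addrA GammaD1 ?ltr_wpDr// IH /rising big_ord_recr/= mulr1.
by rewrite mulrA; congr (_ * _); rewrite mulrC.
Qed.

Lemma rising11 {R : realType} (n : nat) : rising 1 1 n = n`!%:R :> R.
Proof.
elim: n => [|n IH]; first by rewrite /rising big_ord0.
by rewrite /rising big_ord_recr/= -/(rising 1 1 n) IH mulr1 nat1r factS mulnC natrM.
Qed.

Lemma Gamma_nat {R : realType} (n : nat) : Gamma n.+1%:R = n`!%:R :> R.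
Proof. by rewrite -nat1r rising_Gamma// Gamma1 mulr1 rising11. Qed.

(* The tangent line at y of the concave function t |-> t^s gives log-convexity
   of Gamma, without Hoelder's inequality. *)
Lemma Gamma_le_powR {R : realType} (y s : R) : 0 < y -> 0 <= s <= 1 ->
  Gamma (y + s) <= y `^ s * Gamma y.
Proof.
move=> y0 s01; have s0 : 0 <= s by case/andP: s01.
have := gamma_eint_interp y s y0 s01.
rewrite gamma_eintS// -(fineK (gamma_eint_fin_num y y0)) -(fineK (gamma_eint_fin_num (y + s) _)).
  rewrite -!GammaE ?ltr_wpDr// -!EFinM -EFinD lee_fin => /le_trans; apply.
  rewrite powRB; last by rewrite (gt_eqF y0) implybT.
  rewrite powRr1 ?(ltW y0)// le_eqVlt; apply/orP; left; apply/eqP; field.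
  by rewrite (gt_eqF y0).
by rewrite ltr_wpDr.
Qed.

(** * Gauss's formula and the growth of rising factorials *)

Lemma cvg_natV {R : realType} : (n%:R^-1 : R) @[n --> \oo] --> 0.
Proof. by have := @cvg_harmonic R; rewrite -[X in _ -> X]cvg_shiftS. Qed.

Lemma cvg_near_eq {R : realType} (u v : nat -> R) (l : R) :
  (\forall n \near \oo, u n = v n) -> u n @[n --> \oo] --> l -> v n @[n --> \oo] --> l.
Proof. by move=> uv; apply: cvg_trans; exact: near_eq_cvg. Qed.

Lemma cvg_seqM {R : realType} (u v : nat -> R) (a b : R) :
  u n @[n --> \oo] --> a -> v n @[n --> \oo] --> b -> u n * v n @[n --> \oo] --> a * b.
Proof. exact: cvgM. Qed.

Lemma cvg_nat_ratio {R : realType} (t : R) :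
  n%:R / (n%:R + t) @[n --> \oo] --> (1 : R).
Proof.
apply: (@cvg_near_eq _ (fun n => (1 + t * n%:R^-1)^-1)).
  exists 1%N => // n /= n1.
  have n0 : n%:R != 0 :> R by rewrite pnatr_eq0 -lt0n.
  by rewrite -{1}(divff n0) -mulrDl invf_div.
rewrite -[X in _ --> X]invr1; apply: cvgV; first exact: oner_neq0.
rewrite -[X in _ --> X]addr0 -(mulr0 t).
by apply: cvgD; [exact: cvg_cst|apply: cvgM; [exact: cvg_cst|exact: cvg_natV]].
Qed.

(** For 0 <= s <= 1, log-convexity squeezes the ratio between n/(n+s) and 1; the functional equation
    then raises s by 1, at the cost of a factor (n+s-1)/n that tends to 1. *)
Lemma Gamma_ratio_cvg {R : realType} (s : R) : 0 <= s ->
  Gamma (n%:R + s) / (n%:R `^ s * Gamma n%:R) @[n --> \oo] --> (1 : R).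
Proof.
have [k] : exists k : nat, s <= k.+1%:R.
  by exists (Num.truncn s); exact/ltW/truncnS_gt.
elim: k s => [s s1 s0|k IH s sk s0].
  apply: (@squeeze_cvgr _ _ _ _ (fun n => n%:R / (n%:R + s)) (fun=> 1)); last 2 first.
  - exact: cvg_nat_ratio.
  - exact: cvg_cst.
  exists 1%N => // n /= n1; have n0 : 0 < n%:R :> R by rewrite ltr0n.
  have ns0 : 0 < n%:R + s by rewrite ltr_wpDr.
  have D0 : 0 < n%:R `^ s * Gamma n%:R by rewrite mulr_gt0 ?powR_gt0 ?Gamma_gt0.
  apply/andP; split; last by rewrite ler_pdivrMr// mul1r Gamma_le_powR ?s0.
  rewrite ler_pdivlMr// mulrAC ler_pdivrMr//.
  (* The lower bound is the same log-convexity inequality, started from n + s with exponent 1 -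
     s. *)
  have h : n%:R * Gamma n%:R <= (n%:R + s) `^ (1 - s) * Gamma (n%:R + s).
    rewrite -GammaD1//.
    have -> : n%:R + 1 = n%:R + s + (1 - s) by ring.
    by apply: Gamma_le_powR; rewrite // subr_ge0 s1 gerBl.
  rewrite mulrCA (le_trans (ler_wpM2l (powR_ge0 _ _) h))// mulrA [leRHS]mulrC.
  rewrite ler_pM2r ?Gamma_gt0//.
  rewrite -[leRHS](powRr1 (ltW ns0)) -[X in _ <= _ `^ X](subrKC s 1) [leRHS]powRD; last first.
    by rewrite (gt_eqF ns0) implybT.
  by rewrite ler_wpM2r ?powR_ge0// ge0_ler_powR ?nnegrE// ?lerDl// ltW.
have [s1|s1] := leP s 1; first by apply: IH => //; rewrite (le_trans s1)// ler1n.
have := IH (s - 1); rewrite lerBlDr natr1 subr_ge0 => /(_ sk (ltW s1)) h.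
have := cvg_seqM (fun n => (n%:R / (n%:R + (s - 1)))^-1) _ _ _
  (cvgV (@oner_neq0 _) (cvg_nat_ratio (s - 1))) h.
rewrite invr1 mulr1 => /(_ _); apply: cvg_near_eq.
exists 1%N => // n /= n1; have n0 : 0 < n%:R :> R by rewrite ltr0n.
have ns0 : 0 < n%:R + (s - 1) by rewrite ltr_wpDr ?subr_ge0 ?ltW.
have -> : n%:R + s = n%:R + (s - 1) + 1 by ring.
rewrite GammaD1// powRB; last by rewrite (gt_eqF n0) implybT.
rewrite powRr1 ?ltW//; field.
by rewrite !gt_eqF ?powR_gt0 ?Gamma_gt0.
Qed.

(** Gauss's formula, with (a)_(n-1) = Gamma(n+a) / ((n+a-1) Gamma(a)) and n! = n Gamma(n). It serves
    twice: at a = 1 - alpha for the block weights and at a = theta + 1 for the normalising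
    constant. *)
Lemma rising_asymp {R : realType} (a : R) : 0 < a ->
  rising a 1 n.-1 / n`!%:R * n%:R `^ (2 - a) @[n --> \oo] --> (Gamma a)^-1.
Proof.
move=> a0.
have := cvg_seqM _ _ _ _ (cvg_seqM _ _ _ _ (Gamma_ratio_cvg a (ltW a0)) (cvg_nat_ratio (a - 1)))
  (@cvg_cst _ (Gamma a)^-1 _ \oo _).
rewrite !mul1r => /(_ _); apply: cvg_near_eq.
exists 1%N => // -[//|n] _ /=.
have n0 : 0 < n.+1%:R :> R by rewrite ltr0n.
rewrite [n.+1%:R + a]addrC rising_Gamma// Gamma_nat factS natrM /rising big_ord_recr/= mulr1.
rewrite powRB; last by rewrite (gt_eqF n0) implybT.
have -> : n.+1%:R `^ 2 = n.+1%:R ^+ 2 :> R by rewrite powR_mulrn ?ltW.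
have -> : n.+1%:R + (a - 1) = a + n%:R by rewrite -natr1; ring.
field; rewrite !gt_eqF ?powR_gt0 ?Gamma_gt0 ?ltr_wpDr ?ltr0n ?fact_gt0//.
Qed.

(** * Partitions and convolution powers *)

Fixpoint conv_pow {R : nzRingType} (w : nat -> R) (k j : nat) : R :=
  if k is k'.+1 then \sum_(i < j.+1) w i * conv_pow w k' (j - i) else (j == 0)%:R.
Arguments conv_pow : simpl never.

Lemma conv_pow0 {R : nzRingType} (w : nat -> R) (j : nat) : conv_pow w 0 j = (j == 0)%:R.
Proof. by []. Qed.

Lemma conv_pow_rec {R : nzRingType} (w : nat -> R) (k j : nat) :
  conv_pow w k.+1 j = \sum_(i < j.+1) w i * conv_pow w k (j - i).
Proof. by []. Qed.

Lemma sum_subsets_card {R : nzRingType} {T : finType} (A : {set T}) (g : nat -> R) :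
  \sum_(B : {set T} | B \subset A) g #|B| = \sum_(i < #|A|.+1) g i *+ 'C(#|A|, i).
Proof.
rewrite (partition_big (fun B : {set T} => inord #|B| : 'I_#|A|.+1) xpredT)//=.
apply: eq_bigr => i _.
rewrite (eq_bigr (fun=> g i)); last first.
  by move=> B /andP[BA /eqP <-]; rewrite inordK// ltnS subset_leq_card.
rewrite sumr_const -cards_draws; congr (_ *+ _); apply: eq_card => B.
rewrite !inE /in_mem/=; have [BA|] //= := boolP (B \subset A).
by rewrite -val_eqE/= inordK// ltnS subset_leq_card.
Qed.

(** Removing the marked block B is a bijection onto the partitions of the complement of B; the
    equation on [:\] encodes that B is not in P, in the form in which reindexing produces it. *)
Lemma partition_setD1_card {T : finType} (A B : {set T}) (P : {set {set T}}) (k : nat) :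
  B \subset A -> B != finset.set0 ->
  [&& finset.partition (B |: P) A, #|B |: P| == k.+1 & (B |: P) :\ B == P]%SET
  = finset.partition P (A :\: B)%SET && (#|P| == k).
Proof.
move=> BA B0; apply/and3P/andP => [[pA /eqP c /eqP e]|[pA /eqP c]].
  have BP : B \in (B |: P)%SET by rewrite !inE eqxx.
  split; first by rewrite -e; exact: partitionD1.
  by move: c; rewrite (cardsD1 B) BP e add1n => -[->].
have dB : fintype.disjoint (mem B) (mem (A :\: B)%SET).
  by rewrite -finset.setI_eq0; apply/eqP/finset.setP => z; rewrite !inE; case: (z \in B).
have BP : B \notin P.
  apply/negP => BP; move: (partitionS pA BP) => /fintype.subsetP sB.
  move: B0 => /finset.set0Pn[z zB].
  by have := sB _ zB; rewrite !inE zB.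
split.
- have := partitionU1 pA B0 dB; congr (finset.partition _ _).
  apply/finset.setP => z; rewrite !inE; have [zB|//] := boolP (z \in B).
  by rewrite (fintype.subsetP BA).
- by rewrite cardsU1 BP c add1n.
- by rewrite finset.setU1K.
Qed.

(* Marking one of the k+1 blocks gives the recursion in k. *)
Lemma sum_partitionsS {R : comNzRingType} {T : finType} (f : nat -> R) (k : nat)
    (A : {set T}) : f 0 = 0 ->
  k.+1%:R * (\sum_(P : {set {set T}} | finset.partition P A && (#|P| == k.+1))
    \prod_(B in P) f #|B|) =
  \sum_(B : {set T} | B \subset A) f #|B| *
    \sum_(P : {set {set T}} | finset.partition P (A :\: B)%SET && (#|P| == k))
      \prod_(C in P) f #|C|.
Proof.
move=> f0; rewrite mulr_sumr.
rewrite (eq_bigr (fun P : {set {set T}} =>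
    \sum_(B in P) f #|B| * \prod_(C in (P :\ B)%SET) f #|C|)); last first.
  move=> P /andP[_ /eqP cP].
  rewrite [RHS](eq_bigr (fun=> \prod_(B in P) f #|B|)); last first.
    by move=> B BP; rewrite [RHS](big_setD1 B).
  by rewrite sumr_const cP mulr_natl.
rewrite (exchange_big_dep (fun B : {set T} => (B \subset A) && (B != finset.set0)))/=; last first.
  by move=> P B /andP[pP _] BP; rewrite (partitionS pP)// (partition_neq0 pP).
(* The empty set is a subset of A but never a block; its term vanishes by f 0 = 0. *)
rewrite [RHS](bigID (fun B : {set T} => B != finset.set0))/=
  [X in _ = _ + X]big1 ?addr0; last first.
  by move=> B /andP[_ /negbNE/eqP ->]; rewrite cards0 f0 mul0r.
apply: eq_bigr => B /andP[BA B0].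
rewrite mulr_sumr (reindex_onto (fun Q => B |: Q)%SET (fun P => P :\ B)%SET)/=; last first.
  by move=> P /andP[_ BP]; rewrite finset.setD1K.
apply: eq_big => [Q|Q /andP[/andP[_ _] /eqP ->]//].
rewrite -partition_setD1_card// !inE eqxx andbT.
by rewrite andbA.
Qed.

(** Induction on k through the marking recursion: the identity |A|! = C(|A|, i) i! (|A| - i)!
    absorbs the number of choices of the marked block into the weights, and the factor k + 1
    completes the factorial. *)
Lemma sum_partitions {R : numFieldType} {T : finType} (f : nat -> R) (k : nat)
    (A : {set T}) : f 0 = 0 ->
  \sum_(P : {set {set T}} | finset.partition P A && (#|P| == k)) \prod_(B in P) f #|B|
  = (#|A|)`!%:R / k`!%:R * conv_pow (fun i => f i / i`!%:R) k #|A|.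
Proof.
have fact0 i : i`!%:R != 0 :> R by rewrite pnatr_eq0 -lt0n fact_gt0.
move=> f0; elim: k A => [|k IH] A.
  rewrite conv_pow0 divr1 cards_eq0; have [->|A0] := eqVneq A finset.set0.
    rewrite (big_pred1 finset.set0) => [|P].
      by rewrite big1 ?cards0 ?mulr1// => B; rewrite inE.
    by rewrite partition_set0 cards_eq0 andbb.
  rewrite mulr0 big1// => P /andP[pP]; rewrite cards_eq0 => /eqP P0.
  by move: A0; rewrite -(cover_partition pP) P0 /finset.cover big_set0 eqxx.
have k0 : k.+1%:R != 0 :> R by rewrite pnatr_eq0.
apply: (mulfI k0); rewrite sum_partitionsS//.
(* By the induction hypothesis the summand depends on B only through its size. *)
pose g i : R := f i * ((#|A| - i)`!%:R / k`!%:R *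
  conv_pow (fun i => f i / i`!%:R) k (#|A| - i)).
transitivity (\sum_(B : {set T} | B \subset A) g #|B|).
  by apply: eq_bigr => B BA; rewrite IH cardsDS.
rewrite sum_subsets_card conv_pow_rec !mulr_sumr; apply: eq_bigr => i _; rewrite /g.
have iA : (i <= #|A|)%N by rewrite -ltnS.
have -> : (#|A|)`!%:R = 'C(#|A|, i)%:R * (i`!%:R * (#|A| - i)`!%:R) :> R.
  by rewrite -!natrM bin_fact.
rewrite -mulr_natl factS [(k.+1 * _)%:R]natrM; field.
by rewrite nat1r k0 !fact0.
Qed.

(** * Exact law of the smallest block size *)

Lemma measure_finType_pred {R : realType} {d : measure_display} {T : measurableType d}
    (mu : {measure set T -> \bar R}) {I : finType} (X : T -> I) (Q : pred I) :
  (forall i, measurable [set t | X t = i]) ->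
  mu [set t | Q (X t)] = (\sum_(i | Q i) mu [set t | X t = i])%E.
Proof.
move=> mX.
suff H (s : seq I) : uniq s -> measurable [set t | X t \in s] /\
    mu [set t | X t \in s] = (\sum_(i <- s) mu [set t | X t = i])%E.
  rewrite -big_enum/= -(H _ (enum_uniq Q)).2; congr (mu _).
  by apply/seteqP; split => t /=; rewrite mem_enum.
elim: s => [_|i s IH /= /andP[ins us]].
  have -> : [set t | X t \in [::]] = set0 by apply/seteqP; split.
  by split; [exact: measurable0|rewrite big_nil measure0].
have [ms es] := IH us.
have -> : [set t | X t \in i :: s] = [set t | X t = i] `|` [set t | X t \in s].
  apply/seteqP; split => t /=; rewrite inE.
    by move=> /orP[/eqP|]; [left|right].
  by move=> [->|->]; rewrite ?eqxx ?orbT.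
split; first exact: measurableU.
rewrite measureU//; first by rewrite big_cons; congr (_ + _)%E; exact: es.
by apply/seteqP; split => // t /= [Xi Xs]; move: ins; rewrite -Xi Xs.
Qed.

(** An empty [pi] is excluded because the default 0 of [last] would then break the equality for r >
    0. *)
Lemma leq_smallest_block {n : nat} (pi : {set {set 'I_n}}) (r : nat) :
  pi != finset.set0 -> (r <= smallest_block pi)%N = [forall B in pi, r <= #|B|]%N.
Proof.
move=> pi0; rewrite /smallest_block /block_sizes.
set s := [seq _ | _ in _]; set S := sort geq s.
have pS : perm_eq S s by rewrite perm_sort.
have sS : sorted geq S by apply: sort_sorted => i j; exact: leq_total.
have -> : [forall B in pi, r <= #|B|]%N = all (leq r) S.
  rewrite (perm_all _ pS) /s all_map.
  apply/forall_inP/allP => h B; first by rewrite mem_enum; exact: h.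
  by move=> Bpi; apply: h; rewrite mem_enum.
have : S != [::].
  rewrite -size_eq0 (perm_size pS) size_map -cardE cards_eq0//.
case/lastP: S sS {pS} => // S y sS _; rewrite last_rcons all_rcons.
apply/idP/andP => [ry|[]//]; split => //.
(* After reversal the last element comes first in an ascending list, hence bounds all the others
   from below. *)
have : sorted leq (rev (rcons S y)) by rewrite rev_sorted.
rewrite rev_rcons/= => /(order_path_min leq_trans) /allP h.
by apply/allP => z zS; apply: (leq_trans ry); apply: h; rewrite mem_rev.
Qed.

(* The factor i!^-1 turns the multinomial count of set partitions into a plain
   convolution. *)
Definition block_weight {R : realType} (alpha : R) (r i : nat) : R :=
  (if (r <= i)%N then rising (1 - alpha) 1 i.-1 else 0) / i`!%:R.

Lemma risingS {R : realType} (x a : R) (k : nat) :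
  rising x a k.+1 = x * rising (x + a) a k.
Proof.
rewrite /rising big_ord_recl/= mul0r addr0; congr (_ * _).
by apply: eq_bigr => i _; rewrite -nat1r/= mulrDl mul1r addrA.
Qed.

(** Cancelling one factor theta puts the cases theta = 0 and theta <> 0 under one formula. *)
Lemma ewens_pitman_pmfE {R : realType} (alpha theta : R) {n : nat}
    (pi : {set {set 'I_n}}) : (0 < n)%N -> pi != finset.set0 ->
  ewens_pitman_pmf alpha theta pi =
  rising (theta + alpha) alpha #|pi|.-1 / rising (theta + 1) 1 n.-1
    * \prod_(B in pi) rising (1 - alpha) 1 #|B|.-1.
Proof.
move=> n0 pi0; rewrite /ewens_pitman_pmf; case: eqVneq => // t0; congr (_ * _).
have [k ->] : exists k, #|pi| = k.+1 by exists #|pi|.-1; rewrite prednK// card_gt0.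
by case: n n0 pi pi0 => // n _ pi pi0; rewrite !risingS/= -mulf_div divff// mul1r.
Qed.

(** Partitions are grouped by their number k of blocks. The term k = 0, where [k.-1] is 0, vanishes
    because n > 0. *)
Lemma prob_smallest_block_ge {R : realType} {d : measure_display}
    {T : measurableType d} (P : probability T R) (alpha theta : R) (n r : nat)
    (Pi : T -> {set {set 'I_n}}) : (0 < n)%N -> (0 < r)%N ->
  is_ewens_pitman P alpha theta Pi ->
  fine (P [set t | (r <= smallest_block (Pi t))%N]) =
  \sum_(k < n.+1) rising (theta + alpha) alpha k.-1 / k`!%:R
    * (n`!%:R / rising (theta + 1) 1 n.-1 * conv_pow (block_weight alpha r) k n).
Proof.
move=> n0 r0 [pPi mPi PPi].
(* Giving weight 0 to sizes below r turns the event into a sum over all partitions. *)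
pose f i : R := if (r <= i)%N then rising (1 - alpha) 1 i.-1 else 0.
have f0 : f 0 = 0 by rewrite /f leqNgt r0.
have part_neq0 (pi : {set {set 'I_n}}) :
    finset.partition pi [set: 'I_n]%SET -> pi != finset.set0.
  move=> pp; apply/eqP => pi0; move: (card_partition pp).
  by rewrite pi0 big_set0 cardsT card_ord => n00; rewrite n00 in n0.
pose Q (pi : {set {set 'I_n}}) :=
  finset.partition pi [set: 'I_n]%SET && [forall B in pi, r <= #|B|]%N.
have -> : [set t | (r <= smallest_block (Pi t))%N] = [set t | Q (Pi t)].
  by apply/seteqP; split => t /=; rewrite /Q pPi leq_smallest_block// part_neq0.
rewrite measure_finType_pred//.
transitivity (\sum_(pi : {set {set 'I_n}} | finset.partition pi [set: 'I_n]%SET)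
    rising (theta + alpha) alpha #|pi|.-1 / rising (theta + 1) 1 n.-1
    * \prod_(B in pi) f #|B|).
  rewrite (eq_bigr (fun pi => (ewens_pitman_pmf alpha theta pi)%:E)); last first.
    by move=> pi /andP[pp _]; exact: PPi.
  rewrite sumEFin/= /Q big_mkcondr/=; apply: eq_bigr => pi pp.
  case: ifPn => [/forall_inP h|/forall_inPn[B Bpi]].
    rewrite ewens_pitman_pmfE ?part_neq0//; congr (_ * _).
    by apply: eq_bigr => B Bpi; rewrite /f h.
  by rewrite -ltnNge => Br; rewrite (bigD1 B)//= /f leqNgt Br mul0r mulr0.
rewrite (partition_big (fun pi : {set {set 'I_n}} => inord #|pi| : 'I_n.+1) xpredT)//=.
apply: eq_bigr => k _.
(* Blocks are nonempty, so there are at most n of them and [inord] loses nothing. *)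
have kP (pi : {set {set 'I_n}}) : finset.partition pi [set: 'I_n]%SET ->
    (inord #|pi| == k :> 'I_n.+1) = (#|pi| == k).
  move=> pp; rewrite -val_eqE/= inordK// ltnS.
  have := card_partition pp; rewrite cardsT card_ord => cn.
  apply: (@leq_trans (\sum_(B in pi) #|B|)); last by rewrite -cn.
  rewrite -sum1_card; apply: leq_sum => B Bpi.
  by rewrite card_gt0 (partition_neq0 pp).
transitivity (\sum_(pi : {set {set 'I_n}} | finset.partition pi [set: 'I_n]%SET && (#|pi| == k))
    rising (theta + alpha) alpha k.-1 / rising (theta + 1) 1 n.-1
    * \prod_(B in pi) f #|B|).
  apply: eq_big => [pi|pi /andP[pp]].
    by have [/kP ->|] := boolP (finset.partition pi _).
  by rewrite kP// => /eqP ->.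
rewrite -mulr_sumr sum_partitions// cardsT card_ord.
rewrite -[conv_pow _ k n]/(conv_pow (block_weight alpha r) k n); ring.
Qed.

(** * Scaling limit of the convolution powers *)

Lemma powRD_gt0 {R : realType} (x a b : R) : 0 < x -> x `^ (a + b) = x `^ a * x `^ b.
Proof. by move=> x0; rewrite powRD// (gt_eqF x0) implybT. Qed.

Lemma rising_ge0 {R : realType} (a : R) (k : nat) : 0 <= a -> 0 <= rising a 1 k.
Proof. by move=> a0; apply: prodr_ge0 => i _; rewrite mulr1 addr_ge0. Qed.

Lemma block_weight_ge0 {R : realType} (alpha : R) (r i : nat) : alpha < 1 ->
  0 <= block_weight alpha r i.
Proof.
move=> a1; rewrite /block_weight divr_ge0//; case: ifP => // _.
by rewrite rising_ge0// subr_ge0 ltW.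
Qed.

Lemma block_weight_lt {R : realType} (alpha : R) (r i : nat) : (i < r)%N ->
  block_weight alpha r i = 0.
Proof. by move=> ir; rewrite /block_weight leqNgt ir mul0r. Qed.

(** Convergence in [rising_asymp] gives boundedness, and for c n <= i <= n the powers of i and n are
    comparable. *)
Lemma block_weight_bound {R : realType} (alpha c : R) : alpha < 1 -> 0 < c ->
  exists2 C : R, 0 < C & forall n r i : nat, (0 < n)%N -> c * n%:R <= r%:R -> (i <= n)%N ->
    block_weight alpha r i <= C * n%:R `^ (- 1 - alpha).
Proof.
move=> a1 c0.
have a1' : 0 < 1 - alpha by rewrite subr_gt0.
have /cvg_seq_bounded[M [_ HM]] : cvgn (fun n : nat => rising (1 - alpha) 1 n.-1 / n`!%:R
    * n%:R `^ (2 - (1 - alpha)) : R).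
  by apply/cvg_ex; exists (Gamma (1 - alpha))^-1; exact: rising_asymp.
have M1 : M < `|M| + 1 by rewrite (le_lt_trans (ler_norm M))// ltrDl.
have {}HM := HM _ M1.
(* On [c, 1] the power with exponent -1 - alpha is at most 1 or at most c^(-1-alpha), according to
   the sign of the exponent; the sum covers both cases. *)
pose K : R := 1 + c `^ (- 1 - alpha).
have K0 : 0 < K by rewrite ltr_wpDr ?powR_ge0.
exists ((`|M| + 1) * K) => [|n r i n0 cr iN]; first by rewrite mulr_gt0// ltr_wpDl.
have [ir|ri] := ltnP i r.
  by rewrite block_weight_lt// !mulr_ge0 ?powR_ge0 ?(ltW K0)// addr_ge0.
have n0' : 0 < n%:R :> R by rewrite ltr0n.
have ci : c * n%:R <= i%:R by rewrite (le_trans cr)// ler_nat.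
have i0' : 0 < i%:R :> R by apply: lt_le_trans ci; rewrite mulr_gt0.
rewrite /block_weight ri.
have hM : rising (1 - alpha) 1 i.-1 / i`!%:R <= (`|M| + 1) * i%:R `^ (- 1 - alpha).
  have /= := HM i Logic.I; rewrite [X in X <= _ -> _]ger0_norm ?mulr_ge0
    ?powR_ge0 ?invr_ge0 ?rising_ge0 ?(ltW a1')//.
  move=> h; rewrite (le_trans (_ : _ <= (`|M| + 1) / i%:R `^ (2 - (1 - alpha))))//.
    by rewrite ler_pdivlMr ?powR_gt0.
  rewrite -powRN.
  by have -> : - (2 - (1 - alpha)) = - 1 - alpha by ring.
apply: (le_trans hM); rewrite -mulrA ler_wpM2l ?addr_ge0//.
have -> : i%:R `^ (- 1 - alpha) = (i%:R / n%:R) `^ (- 1 - alpha) * n%:R `^ (- 1 - alpha) :> R.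
  by rewrite -powRM ?divfK ?divr_ge0// gt_eqF.
rewrite ler_wpM2r ?powR_ge0//.
have q1 : i%:R / n%:R <= 1 :> R by rewrite ler_pdivrMr// mul1r ler_nat.
have qc : c <= i%:R / n%:R by rewrite ler_pdivlMr.
have q0 : 0 < i%:R / n%:R :> R by rewrite divr_gt0.
have [e0|e0] := leP 0 (- 1 - alpha).
  rewrite /K (le_trans _ (_ : 1 <= _))// ?lerDl ?powR_ge0//.
  apply: (@le_trans _ _ (1 `^ (- 1 - alpha))); last by rewrite powR1.
  by rewrite ge0_ler_powR ?nnegrE ?(ltW q0).
rewrite /K (le_trans _ (_ : c `^ (- 1 - alpha) <= _))// ?lerDr//.
rewrite -[- 1 - alpha]opprK [_ `^ (- _)]powRN [leRHS]powRN lef_pV2 ?posrE ?powR_gt0//.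
by rewrite ge0_ler_powR ?nnegrE ?oppr_ge0 ?(ltW e0) ?(ltW c0) ?(ltW q0).
Qed.

Lemma conv_pow1 {R : nzRingType} (w : nat -> R) (j : nat) : conv_pow w 1 j = w j.
Proof.
rewrite conv_pow_rec big_ord_recr/= subnn conv_pow0 mulr1 big1 ?add0r// => i _.
by rewrite conv_pow0 subn_eq0 leqNgt ltn_ord mulr0.
Qed.

Lemma conv_pow_ge0 {R : numDomainType} (w : nat -> R) (k j : nat) :
  (forall i, 0 <= w i) -> 0 <= conv_pow w k j.
Proof.
by move=> w0; elim: k j => [|k IH] j; rewrite ?conv_pow0 ?ler0n//
  conv_pow_rec sumr_ge0// => i _; rewrite mulr_ge0.
Qed.

(** k blocks of size at least r need k r elements. *)
Lemma conv_pow_eq0 {R : nzRingType} (w : nat -> R) (r k j : nat) :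
  (forall i, (i < r)%N -> w i = 0) -> (j < k * r)%N -> conv_pow w k j = 0.
Proof.
move=> w0; elim: k j => [//|k IH] j jk.
rewrite conv_pow_rec.
apply: big1 => -[i /= ij] _.
have [/w0->|ri] := ltnP i r; first by rewrite mul0r.
by rewrite IH ?mulr0//; move: jk; rewrite mulSn; lia.
Qed.

(** Extends the sum to a range independent of j, as needed for a Riemann sum over [0, 1[. For i >= j
    the truncated difference is 0, where a positive convolution power of w vanishes. *)
Lemma conv_powS {R : nzRingType} (w : nat -> R) (k n j : nat) : w 0 = 0 -> (j <= n)%N ->
  conv_pow w k.+2 j = \sum_(i < n) w i * conv_pow w k.+1 (j - i).
Proof.
move=> w0 jn.
have z k' : conv_pow w k'.+1 0 = 0 by apply: (@conv_pow_eq0 _ _ 1) => // -[].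
rewrite conv_pow_rec big_ord_recr/= subnn z mulr0 addr0.
rewrite (big_ord_widen n (fun i => w i * conv_pow w k.+1 (j - i)))//.
rewrite big_mkcond; apply: eq_bigr => i _; case: ltnP => // ji.
by have /eqP-> : (j - i == 0)%N; rewrite ?subn_eq0// z mulr0.
Qed.

Lemma conv_pow_bound {R : numDomainType} (w : nat -> R) (D : R) (n k j : nat) :
  (forall i, 0 <= w i) -> w 0 = 0 -> (forall i, (i <= n)%N -> w i <= D) -> (j <= n)%N ->
  conv_pow w k.+1 j <= D ^+ k.+1 * n%:R ^+ k.
Proof.
move=> w0 w00 wD; elim: k j => [|k IH] j jn.
  by rewrite conv_pow1 expr1 mulr1 wD.
rewrite (conv_powS _ _ n)//.
apply: (@le_trans _ _ (\sum_(i < n) D * (D ^+ k.+1 * n%:R ^+ k))).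
  apply: ler_sum => i _; apply: ler_pM => //; first exact: conv_pow_ge0.
    by rewrite wD// ltnW.
  by rewrite IH// (leq_trans (leq_subr _ _)).
by rewrite sumr_const card_ord -[leLHS]mulr_natr (exprS D k.+1) [n%:R ^+ k.+1]exprSr !mulrA.
Qed.

(** * Riemann sums and dominated convergence *)

Definition step_fun {R : realType} (n : nat) (phi : nat -> R) (y : R) : R :=
  \sum_(i < n) phi i * \1_(`[i%:R / n%:R, i.+1%:R / n%:R[%classic) y.

Lemma step_funE {R : realType} (n : nat) (phi : nat -> R) (y : R) : (0 < n)%N ->
  0 <= y < 1 -> step_fun n phi y = phi (Num.truncn (n%:R * y)).
Proof.
move=> n0 /andP[y0 y1]; have n0' : 0 < n%:R :> R by rewrite ltr0n.
have ny0 : 0 <= n%:R * y by rewrite mulr_ge0.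
have tn : (Num.truncn (n%:R * y) < n)%N by rewrite truncn_lt_nat// gtr_pMr.
have E i : \1_(`[i%:R / n%:R, i.+1%:R / n%:R[%classic) y
    = (Num.truncn (n%:R * y) == i)%:R :> R.
  rewrite indicE truncn_eq//; congr (_%:R); rewrite mem_setE in_itv/=.
  by rewrite ler_pdivrMr// ltr_pdivlMr// [y * _]mulrC.
rewrite /step_fun (bigD1 (Ordinal tn))//= E eqxx mulr1 big1 ?addr0// => i.
by rewrite -val_eqE/= eq_sym E => /negbTE ->; rewrite mulr0.
Qed.

Lemma measurable_step_fun {R : realType} (n : nat) (phi : nat -> R) (A : set R) :
  measurable_fun A (step_fun n phi).
Proof.
apply: measurable_sum => i; apply: measurable_funM => //.
Qed.

Lemma integral_step_fun {R : realType} (n : nat) (phi : nat -> R) : (0 < n)%N ->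
  (forall i, 0 <= phi i) ->
  (\int[lebesgue_measure]_(y in `[0%R, 1%R[) (step_fun n phi y)%:E
   = (\sum_(i < n) phi i / n%:R)%:E)%E.
Proof.
move=> n0 phi0; have n0' : 0 < n%:R :> R by rewrite ltr0n.
rewrite /step_fun.
under eq_integral do rewrite -sumEFin.
rewrite ge0_integral_sum//; last 2 first.
- move=> i; apply/measurable_EFinP; apply: measurable_funM => //; exact: measurable_indic.
- by move=> i y _; rewrite lee_fin mulr_ge0.
rewrite -sumEFin; apply: eq_bigr => i _.
under eq_integral do rewrite EFinM.
rewrite ge0_integralZl ?lee_fin//; last first.
  by apply/measurable_EFinP; exact: measurable_indic.
rewrite integral_indic//.
have -> : `[i%:R / n%:R, i.+1%:R / n%:R[ `&` `[0%R, 1%R[ =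
    `[i%:R / n%:R, i.+1%:R / n%:R[%classic :> set R.
  apply/setIidPl => y /=; rewrite !in_itv/= => /andP[h1 h2].
  rewrite (le_trans _ h1) ?divr_ge0//= (lt_le_trans h2)// ler_pdivrMr// mul1r ler_nat.
  exact: ltn_ord.
rewrite [RHS]EFinM; congr (_ * _)%E.
rewrite [LHS]lebesgue_measure_itv/= lte_fin ltr_pM2r ?invr_gt0// ltr_nat ltnSn.
by rewrite -EFinB -mulrBl -natr1 addrAC subrr add0r mul1r.
Qed.

(** The sum is the integral of a step function, and dominated convergence applies with a constant
    bound. The points p and q are allowed to be exceptional: in a convolution, each of the two
    factors may jump at one of them. *)
Lemma step_fun_cvg {R : realType} (phi : nat -> nat -> R) (f : R -> R) (M p q : R) :
  (forall n i, 0 <= phi n i) ->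
  (\forall n \near \oo, forall i, (i < n)%N -> phi n i <= M) ->
  (forall y, 0 <= y < 1 -> y != p -> y != q ->
    phi n (Num.truncn (n%:R * y)) @[n --> \oo] --> f y) ->
  lebesgue_measure.-integrable `[0%R, 1%R[ (EFin \o f) /\
  (\sum_(i < n) phi n i / n%:R) @[n --> \oo] -->
    fine (\int[lebesgue_measure]_(y in `[0%R, 1%R[) (f y)%:E)%E.
Proof.
move=> phi0 [N _ HN] phif.
(* The shift puts every index beyond the threshold N and makes the grid size positive. *)
pose g n := step_fun (n + N.+1) (phi (n + N.+1)%N).
have g0 n y : 0 <= g n y by apply: sumr_ge0 => i _; rewrite mulr_ge0.
have gf y : 0 <= y < 1 -> y != p -> y != q -> g n y @[n --> \oo] --> f y.
  move=> y01 yp yq; have := phif y y01 yp yq.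
  rewrite -(cvg_shiftn N.+1); apply: cvg_trans; apply: near_eq_cvg.
  by apply: nearW => n; rewrite /g step_funE// addnS.
pose D : set R := `[0%R, 1%R[%classic.
have mD : measurable D by exact: measurable_itv.
have mf : measurable_fun D f.
  (* Off p and q, f is a pointwise limit of step functions; on single points measurability is
     automatic. *)
  pose E : set R := D `\` ([set p] `|` [set q]).
  apply: (@measurable_funS _ _ _ _ (E `|` ([set p] `|` [set q]))).
  - apply: measurableU; last by apply: measurableU; exact: measurable_set1.
    by apply: measurableD => //; apply: measurableU; exact: measurable_set1.
  - by move=> y Dy; have [h|h] := pselect (([set p] `|` [set q]) y); [right|left].
  - apply/measurable_funU; [|by apply: measurableU; exact: measurable_set1|split].
    + by apply: measurableD => //; apply: measurableU; exact: measurable_set1.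
    + apply: (@measurable_fun_cvg _ _ _ _ g) => [n|y [Dy /not_orP[/eqP yp /eqP yq]]].
        exact: measurable_step_fun.
      by apply: gf => //; move: Dy; rewrite /D /= in_itv.
    + apply/measurable_funU; [exact: measurable_set1|exact: measurable_set1|].
      by split; exact: measurable_fun_set1.
have [] := @dominated_convergence _ _ _ (@lebesgue_measure R) D mD
    (fun n y => (g n y)%:E) (EFin \o f) (cst M%:E).
- by move=> n; apply/measurable_EFinP; exact: measurable_step_fun.
- exact/measurable_EFinP.
- exists ([set p] `|` [set q]); split.
  + by apply: measurableU; exact: measurable_set1.
  + by rewrite null_set_setU//; [exact: lebesgue_measure_set1|exact: lebesgue_measure_set1].
  + move=> y /= h; apply: contrapT => /not_orP[/eqP yp /eqP yq]; apply: h => Dy.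
    apply: cvg_EFin; first exact: nearW.
    by apply: gf => //; move: Dy; rewrite /D /= in_itv.
- apply/integrableP; split; first exact: measurable_cst.
  rewrite (_ : (fun y => _) = cst `|M|%:E)//= integral_cst//.
  rewrite [X in (_ * X)%E](_ : _ = 1%E) ?mule1 ?ltry//.
  by rewrite [LHS]lebesgue_measure_itv/= lte_fin ltr01 oppr0 adde0.
- apply: aeW => y n Dy /=; rewrite lee_fin ger0_norm//.
  have y01 : 0 <= y < 1 by move: Dy; rewrite /D /= in_itv.
  have y0 : 0 <= y by case/andP: y01.
  rewrite /g step_funE ?addnS//; apply: HN; first by rewrite /= ltnW// ltnS leq_addl.
  by rewrite truncn_lt_nat ?mulr_ge0// gtr_pMr ?ltr0n//; case/andP: y01.
move=> intf _ cvgf; split => //.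
rewrite -(cvg_shiftn N.+1).
have ffin : (\int[lebesgue_measure]_(y in D) (f y)%:E)%E \is a fin_num.
  exact: integrable_fin_num intf.
move: cvgf; rewrite /= -[X in _ --> X](fineK ffin) => /fine_cvgP[_].
apply: cvg_trans; apply: near_eq_cvg; apply: nearW => n /=.
by rewrite integral_step_fun// addnS.
Qed.

(* The k+1-fold convolution power of y^(-alpha-1) 1_(x < y). It is correct only
   for z <= 1, the integral being restricted to [0, 1[. *)
Fixpoint cut_conv {R : realType} (alpha x : R) (k : nat) (z : R) : R :=
  let h y := if x < y then y `^ (- alpha - 1) else 0 in
  if k is k'.+1 then
    fine (\int[lebesgue_measure]_(y in `[0%R, 1%R[) (h y * cut_conv alpha x k' (z - y))%:E)%E
  else h z.
Arguments cut_conv : simpl never.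

Lemma cut_convS {R : realType} (alpha x : R) (k : nat) (z : R) :
  cut_conv alpha x k.+1 z = fine (\int[lebesgue_measure]_(y in `[0%R, 1%R[)
    (cut_conv alpha x 0 y * cut_conv alpha x k (z - y))%:E)%E.
Proof. by []. Qed.

(** Makes both the truncated subtraction of the discrete convolution and the restriction of the
    integrals to [0, 1[ harmless. *)
Lemma cut_conv_le0 {R : realType} (alpha x : R) (k : nat) (z : R) : 0 <= x -> z <= 0 ->
  cut_conv alpha x k z = 0.
Proof.
move=> x0; elim: k z => [|k IH] z z0.
  by rewrite /cut_conv ltNge (le_trans z0).
rewrite cut_convS integral0_eq// => y /=; rewrite in_itv/= => /andP[y0 _].
by rewrite IH ?mulr0// subr_le0 (le_trans z0).
Qed.

Lemma cvg_powR {R : realType} (u : nat -> R) (l a : R) : 0 < l ->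
  u n @[n --> \oo] --> l -> u n `^ a @[n --> \oo] --> l `^ a.
Proof.
move=> l0 ul; apply: (cvg_comp u (fun t : R => t `^ a) ul).
apply: (@differentiable_continuous _ _ _ l (fun t : R => t `^ a)); apply/derivable1_diffP.
by apply: derivable_powR; rewrite in_itv/= l0.
Qed.

Lemma cvg_ratio_pinfty {R : realType} (j : nat -> nat) (z : R) : 0 < z ->
  (j n)%:R / n%:R @[n --> \oo] --> z -> j n @[n --> \oo] --> \oo.
Proof.
move=> z0 jz; apply/cvgnyPge => A.
have z2 : z / 2 < z by rewrite ltr_pdivrMr// ltr_pMr// ltr1n.
near=> n.
have n0 : 0 < n%:R :> R by rewrite ltr0n; near: n; exists 1%N.
have h1 : z / 2 < (j n)%:R / n%:R by near: n; exact: (cvgr_gt z).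
have h2 : A%:R / (z / 2) <= n%:R.
  near: n; exists (Num.truncn (A%:R / (z / 2))).+1 => // n /= hn.
  by rewrite (le_trans (ltW (truncnS_gt _)))// ler_nat.
rewrite -(ler_nat R); move: h1; rewrite ltr_pdivlMr// => /ltW; apply: le_trans.
by rewrite mulrC -ler_pdivrMr// divr_gt0.
Unshelve. all: by end_near. Qed.

(** At z = x the limits do not decide whether j n reaches [rho n]; elsewhere the midpoint of x and z
    separates the two ratios for large n. *)
Lemma block_weight_cvg {R : realType} (alpha x z : R) (rho j : nat -> nat) :
  alpha < 1 -> 0 < x -> (rho n)%:R / n%:R @[n --> \oo] --> x ->
  z != x -> (j n)%:R / n%:R @[n --> \oo] --> z ->
  n%:R `^ (1 + alpha) * block_weight alpha (rho n) (j n) @[n --> \oo] -->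
  (Gamma (1 - alpha))^-1 * cut_conv alpha x 0 z.
Proof.
move=> a1 x0 rx zx jz; rewrite /cut_conv.
have a1' : 0 < 1 - alpha by rewrite subr_gt0.
have [xz|zx'|E] := ltgtP x z; last by rewrite E eqxx in zx.
- have z0 := lt_trans x0 xz.
  have := cvg_seqM _ _ _ _ (cvg_comp _ _ (cvg_ratio_pinfty j z z0 jz) (rising_asymp _ a1'))
    (cvg_powR _ _ (- alpha - 1) z0 jz).
  apply: cvg_near_eq; near=> n.
  have n0 : 0 < n%:R :> R by rewrite ltr0n; near: n; exists 1%N.
  have jr : (rho n <= j n)%N.
    rewrite -(ler_nat R) -(ler_pM2r (_ : 0 < n%:R^-1)) ?invr_gt0//.
    apply: (@le_trans _ _ ((x + z) / 2)).
      by near: n; apply: (cvgr_le x) => //; rewrite midf_lt.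
    by near: n; apply: (cvgr_ge z) => //; rewrite midf_lt.
  have j0 : 0 < (j n)%:R :> R.
    rewrite -(ltr_pM2r (_ : 0 < n%:R^-1)) ?invr_gt0// mul0r.
    by near: n; exact: (cvgr_gt z).
  rewrite /block_weight jr /=.
  rewrite (_ : (j n)%:R `^ (2 - (1 - alpha)) =
    ((j n)%:R / n%:R) `^ (1 + alpha) * n%:R `^ (1 + alpha)); last first.
    by rewrite -powRM ?divfK ?divr_ge0 ?gt_eqF//; congr powR; ring.
  rewrite (_ : - alpha - 1 = - (1 + alpha)); last by ring.
  rewrite powRN; field.
  by rewrite pnatr_eq0 -lt0n fact_gt0/= gt_eqF// powR_gt0// divr_gt0.
- rewrite mulr0; apply: (@cvg_near_eq _ (fun=> 0)); last exact: cvg_cst.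
  near=> n; rewrite block_weight_lt ?mulr0//.
  have n0 : 0 < n%:R :> R by rewrite ltr0n; near: n; exists 1%N.
  rewrite -(ltr_nat R) -(ltr_pM2r (_ : 0 < n%:R^-1)) ?invr_gt0//.
  apply: (@lt_trans _ _ ((z + x) / 2)).
    by near: n; apply: (cvgr_lt z) => //; rewrite midf_lt.
  by near: n; apply: (cvgr_gt x) => //; rewrite midf_lt.
Unshelve. all: by end_near. Qed.

(** Provides the constant dominating function for the passage to the limit. *)
Lemma conv_pow_scaled_bound {R : realType} (alpha c : R) : alpha < 1 -> 0 < c ->
  exists2 C : R, 0 < C & forall n r k j : nat, (0 < n)%N -> c * n%:R <= r%:R -> (j <= n)%N ->
    n%:R `^ (1 + k.+1%:R * alpha) * conv_pow (block_weight alpha r) k.+1 j <= C ^+ k.+1.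
Proof.
move=> a1 c0; have [C C0 HC] := block_weight_bound alpha c a1 c0.
exists C => // n r k j n0 cr jn; have n0' : 0 < n%:R :> R by rewrite ltr0n.
have r0 : (0 < r)%N by rewrite -(ltr_nat R); apply: lt_le_trans cr; rewrite mulr_gt0.
have := conv_pow_bound (block_weight alpha r) (C * n%:R `^ (- 1 - alpha)) n k j
  (fun i => block_weight_ge0 _ _ _ a1) (block_weight_lt alpha _ _ r0)
  (fun i => HC n r i n0 cr) jn.
move=> /(ler_wpM2l (powR_ge0 n%:R (1 + k.+1%:R * alpha))) /le_trans; apply.
rewrite exprMn -(powR_mulrn k.+1 (powR_ge0 _ _)) -powRrM -(powR_mulrn k (ltW n0')).
(* The exponents of n cancel: 1 + (k+1) alpha + (k+1) (-1 - alpha) + k = 0. *)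
rewrite -mulrA mulrCA -!powRD_gt0// (_ : _ + _ = 0) ?powRr0 ?mulr1//.
by rewrite -natr1; ring.
Qed.

Lemma cvg_truncn_ratio {R : realType} (y : R) : 0 <= y ->
  (Num.truncn (n%:R * y))%:R / n%:R @[n --> \oo] --> y.
Proof.
move=> y0; apply: (@squeeze_cvgr _ _ _ _ (fun n => y - n%:R^-1) (fun=> y)).
- exists 1%N => // n /= n1; have n0 : 0 < n%:R :> R by rewrite ltr0n.
  have ny0 : 0 <= n%:R * y by rewrite mulr_ge0.
  have /andP[h1 /ltW h2] := truncn_itv ny0.
  rewrite ler_pdivlMr// ler_pdivrMr// mulrBl mulVf ?gt_eqF// lerBlDr natr1.
  by rewrite [y * _]mulrC h1 h2.
- rewrite -[X in _ --> X]subr0; apply: cvgB; [exact: cvg_cst|exact: cvg_natV].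
- exact: cvg_cst.
Qed.

(* The limit is max (z - y) 0, because of the truncated subtraction. *)
Lemma cvg_subn_ratio {R : realType} (j t : nat -> nat) (z y : R) :
  (j n)%:R / n%:R @[n --> \oo] --> z -> (t n)%:R / n%:R @[n --> \oo] --> y ->
  (j n - t n)%:R / n%:R @[n --> \oo] --> Num.max (z - y) 0.
Proof.
have maxE (a : R) : Num.max a 0 = (a + `|a|) / 2.
  by rewrite /Num.max; case: ltP => a0; [rewrite ltr0_norm//|rewrite ger0_norm//]; field.
move=> jz ty; rewrite maxE.
have h : (j n)%:R / n%:R - (t n)%:R / n%:R @[n --> \oo] --> z - y by exact: cvgB.
have h' : (j n)%:R / n%:R - (t n)%:R / n%:R + `|(j n)%:R / n%:R - (t n)%:R / n%:R|
    @[n --> \oo] --> z - y + `|z - y| by apply: cvgD => //; exact: cvg_norm.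
have := cvg_seqM _ _ _ _ h' (@cvg_cst _ (2^-1 : R) _ \oo _).
move=> /(_ _); apply: cvg_near_eq; exists 1%N => // n /= n1.
have n0 : 0 < n%:R :> R by rewrite ltr0n.
rewrite -maxE /= -mulrBl; have [jt|tj] := leqP (j n) (t n).
  by rewrite (eqP (_ : j n - t n == 0)%N) ?subn_eq0// mul0r max_r//
    pmulr_lle0 ?invr_gt0// subr_le0 ler_nat.
by rewrite natrB ?(ltnW tj)// max_l// divr_ge0// subr_ge0 ler_nat ltnW.
Qed.

(** All sequences j with j n / n -> z are allowed, because the induction evaluates the inner
    convolution at a difference that is only asymptotically n (z - y). *)
Definition conv_pow_limit {R : realType} (alpha x : R) (rho : nat -> nat) (k : nat) (z : R) :=
  forall j : nat -> nat, (forall n, (j n <= n)%N) -> (j n)%:R / n%:R @[n --> \oo] --> z ->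
  n%:R `^ (1 + k.+1%:R * alpha) * conv_pow (block_weight alpha (rho n)) k.+1 (j n)
    @[n --> \oo] --> (Gamma (1 - alpha))^-1 ^+ k.+1 * cut_conv alpha x k z.

Lemma conv_pow_limit0 {R : realType} (alpha x : R) (rho : nat -> nat) (z : R) :
  alpha < 1 -> 0 < x -> (rho n)%:R / n%:R @[n --> \oo] --> x -> z != x ->
  conv_pow_limit alpha x rho 0 z.
Proof.
move=> a1 x0 rx zx j _ jz; under eq_cvg do rewrite conv_pow1 mul1r.
exact: block_weight_cvg.
Qed.

(** If the limit at level k may fail only at q, then in the integral over y it may fail only at y =
    z - q, a null set; so level k + 1 has no exceptional point. *)
Lemma conv_pow_limitS {R : realType} (alpha x : R) (rho : nat -> nat) (k : nat) (q z : R) :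
  alpha < 1 -> 0 < x -> (rho n)%:R / n%:R @[n --> \oo] --> x ->
  0 < q -> (forall z, 0 <= z <= 1 -> z != q -> conv_pow_limit alpha x rho k z) ->
  0 <= z <= 1 ->
  lebesgue_measure.-integrable `[0%R, 1%R[
    (fun y => (cut_conv alpha x 0 y * cut_conv alpha x k (z - y))%:E) /\
  conv_pow_limit alpha x rho k.+1 z.
Proof.
move=> a1 x0 rx q0 IH /andP[z0 z1].
set g := (Gamma (1 - alpha))^-1.
have g0 : 0 < g by rewrite invr_gt0 Gamma_gt0// subr_gt0.
(* [rho n] may fall slightly below x n, so the uniform bound is taken at x / 2, which works for
   large n. *)
have x20 : 0 < x / 2 by rewrite divr_gt0.
have [C C0 HC] := conv_pow_scaled_bound alpha (x / 2) a1 x20.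
have rho_near : \forall n \near \oo, (0 < n)%N /\ x / 2 * n%:R <= (rho n)%:R.
  near=> n; split; first by near: n; exists 1%N.
  rewrite -ler_pdivlMr; last by rewrite ltr0n; near: n; exists 1%N.
  by near: n; apply: (cvgr_ge x) => //; rewrite ltr_pdivrMr// ltr_pMr// ltr1n.
pose G z y := cut_conv alpha x 0 y * cut_conv alpha x k (z - y).
have key j : (forall n, (j n <= n)%N) -> (j n)%:R / n%:R @[n --> \oo] --> z ->
    lebesgue_measure.-integrable `[0%R, 1%R[ (EFin \o (fun y => g ^+ k.+2 * G z y)) /\
    n%:R `^ (1 + k.+2%:R * alpha) * conv_pow (block_weight alpha (rho n)) k.+2 (j n)
    @[n --> \oo] --> fine (\int[lebesgue_measure]_(y in `[0%R, 1%R[) (g ^+ k.+2 * G z y)%:E)%E.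
  move=> jn jz.
  pose U n k j := n%:R `^ (1 + k.+1%:R * alpha) * conv_pow (block_weight alpha (rho n)) k.+1 j : R.
  have U0 n l i : 0 <= U n l i.
    by rewrite mulr_ge0 ?powR_ge0 ?conv_pow_ge0// => ?; exact: block_weight_ge0.
  (* Up to the mesh 1/n, this is the i-th term of the rescaled convolution. *)
  pose phi n i := U n 0%N i * U n k (j n - i)%N.
  have [||y /andP[y0 y1] yx yzq|] :=
      step_fun_cvg phi (fun y => g ^+ k.+2 * G z y) (C ^+ 1 * C ^+ k.+1) x (z - q).
  - by move=> n i; rewrite mulr_ge0.
  - apply: filterS rho_near => n [n0 cr] i ni; apply: ler_pM => //.
      by apply: HC => //; exact: ltnW.
    by apply: HC => //; rewrite (leq_trans (leq_subr _ _)).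
  - pose t n := Num.truncn (n%:R * y).
    have tn n : (t n <= n)%N.
      rewrite truncn_le_nat (le_lt_trans (_ : _ <= n%:R)) ?ltr_nat//.
      by rewrite ler_piMr// ltW.
    have ty := cvg_truncn_ratio y y0.
    have h1 := conv_pow_limit0 alpha x rho y a1 x0 rx yx t tn ty.
    have h2 := IH (Num.max (z - y) 0) _ _ (fun n => j n - t n)%N _ (cvg_subn_ratio j t z y jz ty).
    have -> : g ^+ k.+2 * G z y =
        (g ^+ 1 * cut_conv alpha x 0 y) * (g ^+ k.+1 * cut_conv alpha x k (Num.max (z - y) 0)).
      rewrite /G; have [h|h] := leP (z - y) 0.
        by rewrite (cut_conv_le0 _ _ _ (z - y)) ?(cut_conv_le0 _ _ _ 0) ?(ltW x0)// !mulr0.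
        by rewrite expr1 [g ^+ k.+2]exprS; ring.
    apply: cvg_seqM h1 (h2 _ _ _).
    + by rewrite le_max lexx orbT/= ge_max ler01 andbT lerBlDr (le_trans z1)// lerDl.
    (* The maximum avoids q: if it is 0 because q > 0, otherwise because y <> z - q. *)
    + apply/eqP => zyq; move: yzq; rewrite -zyq; case: (leP (z - y) 0) zyq => [h e _|h e].
        by move: q0; rewrite -e ltxx.
      by rewrite opprB addrCA subrr addr0 eqxx.
    + by move=> n; rewrite (leq_trans (leq_subr _ _)).
  - move=> intG; split => //; move: b; apply: cvg_near_eq.
    apply: filterS rho_near => n [n0 cr].
    have n0' : 0 < n%:R :> R by rewrite ltr0n.
    have r0 : (0 < rho n)%N.
      by rewrite -(ltr_nat R); apply: lt_le_trans cr; rewrite mulr_gt0.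
    rewrite (conv_powS _ _ n)//; last exact: block_weight_lt.
    rewrite mulr_sumr; apply: eq_bigr => i _; rewrite /phi /U conv_pow1.
    set A := 1 + 1%:R * alpha; set B := 1 + k.+1%:R * alpha.
    (* The exponents of the two factors exceed that of the product by one; the spare n^-1 is the
       mesh. *)
    have -> : 1 + k.+2%:R * alpha = A + B + (- 1) by rewrite /A /B -[k.+2%:R]natr1; ring.
    rewrite (powRD_gt0 _ (A + B) _ n0') (powRD_gt0 _ A _ n0') powR_inv1 ?(ltW n0')//.
    ring.
(* One admissible sequence suffices for integrability; the truncations of n z are used, and the
   constant is divided out. *)
have intG : lebesgue_measure.-integrable `[0%R, 1%R[ (fun y => (G z y)%:E).
  have zn n : (Num.truncn (n%:R * z) <= n)%N.
    rewrite truncn_le_nat (le_lt_trans (_ : _ <= n%:R)) ?ltr_nat//.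
    by rewrite ler_piMr.
  have [i1 _] := key _ zn (cvg_truncn_ratio z z0).
  have i2 : lebesgue_measure.-integrable `[0%R, 1%R[
      (fun y => ((g ^+ k.+2)^-1)%:E * (g ^+ k.+2 * G z y)%:E)%E by exact: integrableZl.
  apply: eq_integrable i2 => // y _ /=.
  by rewrite -EFinM mulKf// expf_neq0// gt_eqF.
split => // j jn jz; have [_] := key j jn jz; congr (_ --> _).
rewrite cut_convS.
under eq_integral do rewrite EFinM.
rewrite integralZl//.
by rewrite fineM// integrable_fin_num.
Unshelve. all: by end_near. Qed.

(** The exceptional point z = x occurs only for k = 0; one convolution removes it. *)
Lemma conv_pow_cvg {R : realType} (alpha x : R) (rho : nat -> nat) (k : nat) (z : R) :
  alpha < 1 -> 0 < x -> (rho n)%:R / n%:R @[n --> \oo] --> x ->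
  0 <= z <= 1 -> (0 < k)%N || (z != x) -> conv_pow_limit alpha x rho k z.
Proof.
move=> a1 x0 rx; elim: k z => [|k IH] z z01 /= kz; first exact: conv_pow_limit0.
apply: (conv_pow_limitS alpha x rho k x z _ _ _ _ _ _).2 => // y y01 yx.
by apply: IH => //; rewrite yx orbT.
Qed.

(** A by-product of dominated convergence, for the discrete model with thresholds truncated from n
    x. *)
Lemma integrable_cut_conv {R : realType} (alpha x : R) (k : nat) (z : R) :
  alpha < 1 -> 0 < x -> 0 <= z <= 1 ->
  lebesgue_measure.-integrable `[0%R, 1%R[
    (fun y => (cut_conv alpha x 0 y * cut_conv alpha x k (z - y))%:E).
Proof.
move=> a1 x0 z01.
pose rho n := Num.truncn (n%:R * x).
have rx : (rho n)%:R / n%:R @[n --> \oo] --> x by apply: cvg_truncn_ratio; exact: ltW.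
apply: (conv_pow_limitS alpha x rho k x z _ _ _ _ _ _).1 => // y y01 yx.
by apply: conv_pow_cvg => //; rewrite yx orbT.
Qed.

(** * Dirichlet integrals *)

Lemma integral_Rn0 {R : realType} (b : nat) : integral_Rn b (fun=> 0%E) = 0%E :> \bar R.
Proof. by elim: b => [//|b IH] /=; under eq_integral do rewrite IH; rewrite integral0. Qed.

Lemma eq_integral_Rn {R : realType} (b : nat) (f g : seq R -> \bar R) :
  f =1 g -> integral_Rn b f = integral_Rn b g.
Proof. by move=> /funext ->. Qed.

(** The Dirichlet integrand with nu = rho = -alpha and p = q = x, on a simplex of total mass z, so
    that one variable can be peeled off. *)
Definition simplex_integrand {R : realType} (alpha x z : R) (s : seq R) : R :=
  if all (fun y => x < y) s && (\sum_(y <- s) y < z - x)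
  then (z - \sum_(y <- s) y) `^ (- alpha - 1) * \prod_(y <- s) y `^ (- alpha - 1) else 0.

Lemma simplex_integrand_cons {R : realType} (alpha x z y : R) (s : seq R) :
  simplex_integrand alpha x z (y :: s) =
  cut_conv alpha x 0 y * simplex_integrand alpha x (z - y) s.
Proof.
rewrite /simplex_integrand /cut_conv /= !big_cons; case: ltP => _ /=; last by rewrite mul0r.
have -> : (\sum_(j <- s) j < z - y - x) = (y + \sum_(j <- s) j < z - x).
  by rewrite [z - y - x]addrAC [LHS]ltrBrDl.
by case: ifP => _; rewrite ?mulr0// opprD addrA mulrCA.
Qed.

(** The constant c lets the induction absorb the power of the outer variable. *)
Lemma integral_Rn_simplex {R : realType} (alpha x : R) (b : nat) (c z : R) :
  alpha < 1 -> 0 < x -> z <= 1 ->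
  integral_Rn b (fun s => (c * simplex_integrand alpha x z s)%:E) =
  (c * cut_conv alpha x b z)%:E.
Proof.
move=> a1 x0; elim: b c z => [|b IH] c z z1.
  by rewrite /= /simplex_integrand /cut_conv /= !big_nil subr0 subr_gt0 mulr1.
pose G y := cut_conv alpha x 0 y * cut_conv alpha x b (z - y).
transitivity (\int[lebesgue_measure]_y (c * G y)%:E)%E.
  apply: eq_integral => y _.
  have [xy|yx] := ltP x y.
    transitivity (integral_Rn b (fun s =>
        (c * cut_conv alpha x 0 y * simplex_integrand alpha x (z - y) s)%:E)).
      by apply: eq_integral_Rn => s; rewrite simplex_integrand_cons mulrA.
    by rewrite IH ?mulrA// lerBlDr (le_trans z1)// lerDl ltW// (lt_trans x0).
  have h0 : cut_conv alpha x 0 y = 0 by rewrite /cut_conv ltNge yx.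
  rewrite /G h0 mul0r mulr0 -[RHS](integral_Rn0 b); apply: eq_integral_Rn => s.
  by rewrite simplex_integrand_cons h0 mul0r mulr0.
have [z0|z0] := leP z 0.
  rewrite cut_conv_le0 ?(ltW x0)// mulr0 integral0_eq// => y _.
  rewrite /G; have [xy|yx] := ltP x y.
    by rewrite (cut_conv_le0 _ _ b) ?mulr0 ?(ltW x0)// subr_le0 (le_trans z0)// ltW// (lt_trans x0).
  by rewrite /cut_conv ltNge yx mul0r mulr0.
have intG : lebesgue_measure.-integrable `[0%R, 1%R[ (EFin \o G).
  by apply: integrable_cut_conv => //; rewrite (ltW z0).
rewrite cut_convS EFinM fineK; last exact: integrable_fin_num intG.
rewrite -integralZl// [RHS]integral_mkcond.
(* Outside [0, 1[ the integrand vanishes: the first factor for y < 0, the second for y >= 1, as z -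
   y <= 0. *)
apply: eq_integral => y _; rewrite patchE; case: ifPn => // /negP.
rewrite inE/= in_itv/= => /negP; rewrite negb_and -ltNge -leNgt => /orP[y0|y1].
  by rewrite /G /cut_conv ltNge (ltW (lt_trans y0 x0)) mul0r mulr0.
by rewrite /G (cut_conv_le0 _ _ b) ?mulr0 ?(ltW x0)// subr_le0 (le_trans z1).
Qed.

(** The b + 1 free variables and the last coordinate give b + 2 equal factors, that is, [cut_conv]
    of index b + 1. *)
Lemma incomplete_dirichletS {R : realType} (alpha x : R) (b : nat) : alpha < 1 -> 0 < x ->
  incomplete_dirichlet x x b.+1 (- alpha) (- alpha) =
  Gamma (- b.+2%:R * alpha) / Gamma (- alpha) ^+ b.+2 * cut_conv alpha x b.+1 1.
Proof.
move=> a1 x0; rewrite /incomplete_dirichlet -exprS.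
have -> : - alpha + b.+1%:R * - alpha = - b.+2%:R * alpha by rewrite -[b.+2%:R]natr1; ring.
congr (_ * _); have := integral_Rn_simplex alpha x b.+1 1 1 a1 x0 (lexx 1).
rewrite mul1r; have -> : (fun s => (1 * simplex_integrand alpha x 1 s)%:E) =
    (fun s => (dirichlet_integrand x x (- alpha) (- alpha) s)%:E).
  by apply/funext => s; rewrite mul1r.
by move=> ->.
Qed.

(** * Asymptotics of the smallest block *)

Lemma cvg_ord_sum {R : realType} (N : nat) (u : nat -> nat -> R) (l : nat -> R) :
  (forall k, (k < N)%N -> u k n @[n --> \oo] --> l k) ->
  \sum_(k < N) u k n @[n --> \oo] --> \sum_(k < N) l k.
Proof.
elim: N => [_|N IH ul].
  by rewrite big_ord0; under eq_cvg do rewrite big_ord0; exact: cvg_cst.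
rewrite big_ord_recr/=; under eq_cvg do rewrite big_ord_recr/=.
by apply: cvgD; [apply: IH => k kN; apply: ul; exact: ltnW|exact: ul].
Qed.

Lemma cvg_nat_powR0 {R : realType} (e : R) : e < 0 -> n%:R `^ e @[n --> \oo] --> (0 : R).
Proof.
move=> e0; apply/cvgrPdist_le => d d0; near=> n.
have n0 : 0 < n%:R :> R by rewrite ltr0n; near: n; exists 1%N.
have ne0 : 0 < - e by rewrite oppr_gt0.
rewrite sub0r normrN ger0_norm ?powR_ge0//.
have -> : d = (d `^ e^-1) `^ e by rewrite -powRrM mulVf ?lt_eqF// powRr1 ?ltW.
rewrite -[e in leLHS]opprK -[X in _ <= _ `^ X]opprK [leLHS]powRN [leRHS]powRN.
rewrite lef_pV2 ?posrE ?powR_gt0//.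
rewrite ge0_ler_powR ?nnegrE ?powR_ge0 ?(ltW ne0)//.
near: n; exists (Num.truncn (d `^ e^-1)).+1 => // n /= hn.
by rewrite (le_trans (ltW (truncnS_gt _)))// ler_nat.
Unshelve. all: by end_near. Qed.

Lemma sum_ord_trunc {V : nmodType} (m M : nat) (t : nat -> V) : (m <= M)%N ->
  (forall k, (m <= k)%N -> t k = 0) -> \sum_(k < M) t k = \sum_(k < m) t k.
Proof.
move=> mM t0; rewrite (big_ord_widen M t mM) [RHS]big_mkcond.
by apply: eq_bigr => k _; case: ltnP => // /t0.
Qed.

(** Passes from integer thresholds to natural ones: as x > 0, r n is eventually positive. *)
Lemma ratio_abs_cvg {R : realType} (x : R) (r : nat -> int) : 0 < x ->
  asymp_equiv (fun n => (r n)%:~R) (fun n => x * n%:R) ->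
  (\forall n \near \oo, r n = (`|r n|%N)%:Z /\ (0 < `|r n|)%N) /\
  (`|r n|%N)%:R / n%:R @[n --> \oo] --> x.
Proof.
rewrite /asymp_equiv => x0 h.
have pos : \forall n \near \oo, r n = (`|r n|%N)%:Z /\ (0 < `|r n|)%N.
  near=> n.
  have n0 : 0 < n%:R :> R by rewrite ltr0n; near: n; exists 1%N.
  have : 0 < (r n)%:~R / (x * n%:R) :> R by near: n; exact: (cvgr_gt 1).
  rewrite pmulr_lgt0 ?invr_gt0 ?mulr_gt0// ltr0z => r0.
  by rewrite absz_gt0 gtz0_abs// gt_eqF.
split => //.
have := cvg_seqM _ _ _ _ h (@cvg_cst _ x _ \oo _).
rewrite mul1r => /(_ _); apply: cvg_near_eq; near=> n.
have n0 : 0 < n%:R :> R by rewrite ltr0n; near: n; exists 1%N.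
have [-> _] : r n = (`|r n|%N)%:Z /\ (0 < `|r n|)%N by near: n.
by rewrite absz_nat -pmulrn; field; rewrite !gt_eqF.
Unshelve. all: by end_near. Qed.

(** Index k stands for k + 1 blocks. After rescaling by n^s its term is [a k] times convergent
    factors times n^(e k), so only the terms with [e k = 0] can contribute; s is chosen in each
    regime to single out the dominant term. *)
Lemma prob_smallest_block_cvg {R : realType} (d : nat -> measure_display)
    (T : forall n : nat, measurableType (d n)) (P : forall n : nat, probability (T n) R)
    (Pi : forall n : nat, T n -> {set {set 'I_n}}) (alpha theta x s : R)
    (r : nat -> int) (N : nat) :
  (forall n : nat, (0 < n)%N -> is_ewens_pitman (P n) alpha theta (Pi n)) ->
  alpha < 1 -> -1 < theta -> 0 < x -> x < 1 -> x^-1 < N.+1%:R ->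
  asymp_equiv (fun n => (r n)%:~R) (fun n => x * n%:R) ->
  let a k := rising (theta + alpha) alpha k / (k.+1)`!%:R in
  let e k := - theta - k.+1%:R * alpha + s in
  (forall k, (k < N)%N -> a k = 0 \/ e k <= 0) ->
  fine (P n [set t | r n <= (smallest_block (Pi n t))%:Z]) * n%:R `^ s @[n --> \oo] -->
  \sum_(k < N) (if e k == 0 then a k * (Gamma (1 + theta) *
    ((Gamma (1 - alpha))^-1 ^+ k.+1 * cut_conv alpha x k 1)) else 0).
Proof.
move=> HPi a1 th x0 x1 xN /(ratio_abs_cvg x r x0)[r_pos rho_cvg] a e ae.
set rho := fun n => `|r n|%N.
have t1 : 0 < theta + 1 by rewrite -ltrBlDr sub0r.
(* The normalising constant, rescaled by the inverse of the power in [rising_asymp] at theta + 1. *)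
pose b n : R := n`!%:R / rising (theta + 1) 1 n.-1 * n%:R `^ (theta - 1).
pose U k n : R := n%:R `^ (1 + k.+1%:R * alpha) * conv_pow (block_weight alpha (rho n)) k.+1 n.
have b_cvg : b n @[n --> \oo] --> Gamma (1 + theta).
  rewrite -[Gamma _]invrK [1 + theta]addrC.
  have g1 : (Gamma (theta + 1))^-1 != 0 by rewrite gt_eqF// invr_gt0 Gamma_gt0.
  have := cvgV g1 (rising_asymp _ t1).
  move=> /(_ _); apply: cvg_near_eq.
  apply: nearW => n; rewrite /b invfM invf_div; congr (_ * _).
  by rewrite -powRN; congr powR; ring.
(* Eventually (N + 1) [rho n] > n, so at most N blocks fit. *)
have xN2 : N.+1%:R^-1 < x by rewrite -[ltRHS]invrK ltf_pV2 ?posrE ?invr_gt0.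
have rho_gt : \forall n \near \oo, N.+1%:R^-1 < ((rho n)%:R / n%:R : R).
  exact: (cvgr_gt _ rho_cvg _ xN2).
have expand : \forall n \near \oo,
    fine (P n [set t | r n <= (smallest_block (Pi n t))%:Z]) * n%:R `^ s =
    \sum_(k < N) a k * (b n * (U k n * n%:R `^ e k)).
  near=> n.
  have n0 : (0 < n)%N by near: n; exists 1%N.
  have nN : (N <= n)%N by near: n; exists N.
  have n0' : 0 < n%:R :> R by rewrite ltr0n.
  have [rE rho0] : r n = (rho n)%:Z /\ (0 < rho n)%N by near: n.
  have rN : (n < N.+1 * rho n)%N.
    rewrite -(ltr_nat R) natrM -ltr_pdivrMl//.
    have : N.+1%:R^-1 < (rho n)%:R / n%:R :> R by near: n; exact: rho_gt.
    by rewrite ltr_pdivlMr.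
  have -> : [set t | r n <= (smallest_block (Pi n t))%:Z] =
      [set t | (rho n <= smallest_block (Pi n t))%N].
    by apply/seteqP; split => t /=; rewrite rE lez_nat.
  rewrite (prob_smallest_block_ge (P n) alpha theta n (rho n) (Pi n) n0 rho0 (HPi n n0)).
  rewrite big_ord_recl/= conv_pow0 (gtn_eqF n0) !mulr0 add0r.
  pose t k := rising (theta + alpha) alpha k / k.+1`!%:R
    * (n`!%:R / rising (theta + 1) 1 n.-1 * conv_pow (block_weight alpha (rho n)) k.+1 n).
  transitivity ((\sum_(k < n) t k) * n%:R `^ s); first by [].
  rewrite (@sum_ord_trunc _ N)//; last first.
    move=> k Nk; rewrite /t (conv_pow_eq0 _ (rho n)) ?mulr0//.
      by move=> i; exact: block_weight_lt.
    by apply: (leq_trans rN); rewrite leq_mul2r ltnS Nk orbT.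
  rewrite mulr_suml; apply: eq_bigr => k _.
  (* Splits s as (theta - 1) + (1 + (k+1) alpha) + [e k], one power for each factor. *)
  have -> : n%:R `^ s = n%:R `^ (theta - 1) * n%:R `^ (1 + k.+1%:R * alpha) * n%:R `^ e k.
    by rewrite -!powRD_gt0//; congr powR; rewrite /e; ring.
  by rewrite /t /a /b /U; ring.
apply: (@cvg_near_eq _ (fun n => \sum_(k < N) a k * (b n * (U k n * n%:R `^ e k)))).
  by apply: filterS expand => n ->.
apply: (cvg_ord_sum N (fun k n => a k * (b n * (U k n * n%:R `^ e k)))
  (fun k => if e k == 0 then a k * (Gamma (1 + theta) *
    ((Gamma (1 - alpha))^-1 ^+ k.+1 * cut_conv alpha x k 1)) else 0)) => k kN.
have U_cvg : U k n @[n --> \oo] --> (Gamma (1 - alpha))^-1 ^+ k.+1 * cut_conv alpha x k 1.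
  apply: (conv_pow_cvg alpha x rho k 1 a1 x0 rho_cvg) => //.
  - by rewrite ler01 lexx.
  - by rewrite (gt_eqF x1) orbT.
  - apply: (@cvg_near_eq _ (fun=> 1)); last exact: cvg_cst.
    by exists 1%N => // n /= n1; rewrite divff// pnatr_eq0 -lt0n.
case: eqVneq => [->|ek].
  apply: cvg_seqM; first exact: cvg_cst.
  by apply: cvg_seqM => //; under eq_cvg do rewrite powRr0 mulr1.
have [->|ek0] := ae k kN.
  by under eq_cvg do rewrite mul0r; exact: cvg_cst.
rewrite -(mulr0 (a k)); apply: cvg_seqM; first exact: cvg_cst.
rewrite -(mulr0 (Gamma (1 + theta))); apply: cvg_seqM => //.
rewrite -(mulr0 ((Gamma (1 - alpha))^-1 ^+ k.+1 * cut_conv alpha x k 1)).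
by apply: cvg_seqM => //; apply: cvg_nat_powR0; rewrite lt_neqAle ek ek0.
Unshelve. all: by end_near. Qed.

Lemma cut_conv01 {R : realType} (alpha x : R) : x < 1 -> cut_conv alpha x 0 1 = 1.
Proof. by move=> x1; rewrite /cut_conv x1 powR1. Qed.

(** With c = -alpha and k = m - 1 this is the coefficient of the last nonzero term when theta = -m
    alpha. *)
Lemma risingN {R : realType} (c : R) (k : nat) : rising (k%:R * c) (- c) k = c ^+ k * k`!%:R.
Proof.
elim: k => [|k IH]; first by rewrite /rising big_ord0 mulr1.
rewrite risingS (_ : k.+1%:R * c - c = k%:R * c); last by rewrite -natr1; ring.
by rewrite IH factS natrM exprS; ring.
Qed.

Lemma rising_eq0 {R : realType} (x a : R) (i k : nat) : (i < k)%N -> x + i%:R * a = 0 ->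
  rising x a k = 0.
Proof. by move=> ik xi0; rewrite /rising (bigD1 (Ordinal ik))//= xi0 mul0r. Qed.

Theorem corollary4p2 (R : realType) (d : nat -> measure_display)
    (T : forall n : nat, measurableType (d n))
    (P : forall n : nat, probability (T n) R)
    (Pi : forall n : nat, T n -> {set {set 'I_n}})
    (alpha theta : R)
    (HPi : forall n : nat, (0 < n)%N -> is_ewens_pitman (P n) alpha theta (Pi n))
    (x : R) (x_gt0 : 0 < x) (x_lt1 : x < 1)
    (r : nat -> int)
    (Hr : asymp_equiv (fun n => (r n)%:~R) (fun n => x * n%:R)) :
  let prob_ge (n : nat) : R :=
    fine (P n [set t | r n <= (smallest_block (Pi n t))%:Z]) in
  (0 < alpha -> alpha < 1 -> - alpha < theta ->
     asymp_equiv prob_ge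
       (fun n => Gamma (1 + theta) / Gamma (1 - alpha)
                 * n%:R `^ (- theta - alpha)))
  /\
  (forall m : nat, (1 <= m)%N -> alpha < 0 -> theta = - (m%:R * alpha) ->
     (m%:R <= x^-1 ->
        prob_ge n @[n --> \oo] -->
          incomplete_dirichlet x x m.-1 (- alpha) (- alpha))
     /\
     (x^-1 < m%:R ->
        prob_ge =O_\oo
          (fun n : nat =>
             n%:R `^ ((m%:R - (Num.floor x^-1)%:~R) * alpha) : R))).
Proof.
move=> prob_ge.
(* The largest number of blocks to be considered: N + 1 blocks of size r do not fit for large n. *)
pose N := Num.truncn x^-1.
have xV0 : 0 <= x^-1 by rewrite invr_ge0 ltW.
have /andP[Nx xN] := truncn_itv xV0.
have N0 : (0 < N)%N by rewrite truncn_gt0 invf_ge1// ltW.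
have floorN : (Num.floor x^-1)%:~R = N%:R :> R.
  by rewrite /N truncn_floor xV0 natr_absz ger0_norm// floor_ge0.
split=> [a0 a1 ta|m m1 aneg thetaE].
  have th : -1 < theta by rewrite (lt_trans _ ta)// ltrN2.
  have G1 : 0 < Gamma (1 + theta) by rewrite Gamma_gt0// -ltrBlDl sub0r.
  have G2 : 0 < Gamma (1 - alpha) by rewrite Gamma_gt0// subr_gt0.
  (* With s = theta + alpha the exponents are -k alpha, so the one-block partition dominates. *)
  have eE (k : nat) : - theta - k.+1%:R * alpha + (theta + alpha) = - (k%:R * alpha).
    by rewrite -natr1; ring.
  have aeE (k : nat) : (k < N)%N -> rising (theta + alpha) alpha k / (k.+1)`!%:R = 0 \/
      - theta - k.+1%:R * alpha + (theta + alpha) <= 0.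
    by move=> _; right; rewrite eE oppr_le0 mulr_ge0// ltW.
  have := prob_smallest_block_cvg d T P Pi alpha theta x (theta + alpha) r N
    HPi a1 th x_gt0 x_lt1 xN Hr aeE.
  rewrite (bigD1 (Ordinal N0))//= big1 ?addr0; last first.
    move=> k; rewrite -val_eqE/= eE oppr_eq0 mulf_eq0 pnatr_eq0 => /negbTE ->.
    by rewrite (gt_eqF a0).
  rewrite eE mul0r oppr0 eqxx cut_conv01// expr1 mulr1 /rising big_ord0 divr1 mul1r.
  move=> h; rewrite /asymp_equiv.
  have := cvg_seqM _ _ _ _ h (@cvg_cst _ (Gamma (1 + theta) / Gamma (1 - alpha))^-1 _ \oo _).
  rewrite divff; last by rewrite gt_eqF// divr_gt0.
  move=> /(_ _); apply: cvg_near_eq.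
  apply: nearW => n; rewrite (_ : - theta - alpha = - (theta + alpha)); last by ring.
  by rewrite powRN [in RHS]invfM invrK mulrAC mulrA.
have a1 : alpha < 1 by rewrite (lt_trans aneg).
have b0 : 0 < - alpha by rewrite oppr_gt0.
have th0 : 0 < theta by rewrite thetaE -mulrN mulr_gt0// ltr0n.
have th : -1 < theta by rewrite (lt_trans _ th0)// oppr_lt0.
split=> [mx|xm].
- have mN : (m <= N)%N by rewrite /N truncn_ge_nat.
  (* With s = 0 the exponent is 0 only for k + 1 = m blocks. *)
  have eE (k : nat) : - theta - k.+1%:R * alpha + 0 = (m%:R - k.+1%:R) * alpha.
    by rewrite thetaE; ring.
  have aeE (k : nat) : (k < N)%N -> rising (theta + alpha) alpha k / (k.+1)`!%:R = 0 \/
      - theta - k.+1%:R * alpha + 0 <= 0.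
    move=> kN; have [km|mk] := ltnP k m.
      by right; rewrite eE mulr_ge0_le0 ?(ltW aneg)// subr_ge0 ler_nat.
    (* Beyond m blocks the coefficient contains the factor theta + alpha + (m-1) alpha = 0. *)
    left; rewrite (rising_eq0 _ _ m.-1 k) ?mul0r//; first by rewrite prednK.
    by rewrite thetaE -{1}(prednK m1) -natr1; ring.
  have := prob_smallest_block_cvg d T P Pi alpha theta x 0 r N
    HPi a1 th x_gt0 x_lt1 xN Hr aeE.
  have m1N : (m.-1 < N)%N by rewrite prednK.
  rewrite (bigD1 (Ordinal m1N))//= big1; last first.
    move=> k; rewrite -val_eqE/= eE mulf_eq0 subr_eq0 eqr_nat (lt_eqF aneg) orbF.
    by rewrite -{2}(prednK m1) eqSS eq_sym => /negbTE ->.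
  rewrite eE prednK// subrr mul0r eqxx addr0.
  under eq_cvg do rewrite powRr0 mulr1.
  suff -> : rising (theta + alpha) alpha m.-1 / m`!%:R * (Gamma (1 + theta) *
      ((Gamma (1 - alpha))^-1 ^+ m * cut_conv alpha x m.-1 1)) =
      incomplete_dirichlet x x m.-1 (- alpha) (- alpha) by [].
  (* For m = 1 the Dirichlet integral is 1 by convention, and theta = -alpha makes the two Gamma
     values equal. *)
  case: m m1 {eE aeE m1N} thetaE mx mN => [//|[|b]] _ thetaE mx mN.
    rewrite /= cut_conv01// /rising big_ord0 divr1 mul1r expr1 mulr1.
    rewrite thetaE mul1r mulfV// gt_eqF// Gamma_gt0// addr_gt0//.
  rewrite [RHS]incomplete_dirichletS//.
  have -> : theta + alpha = b.+1%:R * (- alpha) by rewrite thetaE -natr1; ring.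
  have -> : 1 + theta = b.+2%:R * (- alpha) + 1 by rewrite thetaE; ring.
  (* The coefficient becomes (-alpha)^(b+1) (b+1)! / (b+2)!; the functional equation, applied to
     both Gamma values, cancels it. *)
  rewrite -{2}[alpha]opprK risingN [1 - alpha]addrC mulNr -mulrN.
  rewrite !GammaD1//; last by rewrite mulr_gt0.
  have G0 : Gamma (- alpha) ^+ b.+2 != 0 by rewrite expf_neq0// gt_eqF// Gamma_gt0.
  have B0 : (- alpha) ^+ b.+1 != 0 by rewrite expf_neq0// gt_eqF.
  have f0 : (b.+1)`!%:R != 0 :> R by rewrite pnatr_eq0 -lt0n fact_gt0.
  rewrite exprVn exprMn [(- alpha) ^+ b.+2]exprS (factS b.+1) [(b.+2 * _)%:R]natrM.
  move: G0 B0 f0 b0; move: (Gamma _ ^+ _) ((- alpha) ^+ _) ((b.+1)`!%:R) => G B f G0 B0 f0 b0.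
  have b2 : b.+2%:R != 0 :> R by rewrite pnatr_eq0.
  by field; rewrite G0 B0 f0 (lt_eqF aneg) -natrD add2n.
(* This scale gives exponent 0 to k + 1 = N blocks, the dominant number for alpha < 0. *)
- have aeE (k : nat) : (k < N)%N -> rising (theta + alpha) alpha k / (k.+1)`!%:R = 0 \/
      - theta - k.+1%:R * alpha + - ((m%:R - N%:R) * alpha) <= 0.
    move=> kN; right; rewrite (_ : _ + _ = (N%:R - k.+1%:R) * alpha); last by rewrite thetaE; ring.
    by rewrite mulr_ge0_le0 ?(ltW aneg)// subr_ge0 ler_nat.
  have /cvgP h := prob_smallest_block_cvg d T P Pi alpha theta x (- ((m%:R - N%:R) * alpha))
    r N HPi a1 th x_gt0 x_lt1 xN Hr aeE.
  (* A convergent sequence is bounded, which is the O estimate. *)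
  have [M [_ HM]] := cvg_seq_bounded h.
  apply/eqO_exP; exists (`|M| + 1); first by rewrite ltr_wpDl.
  have M1 : M < `|M| + 1 by rewrite (le_lt_trans (ler_norm M))// ltrDl.
  near=> n; have /= := HM _ M1 n Logic.I.
  have n0 : 0 < n%:R :> R by rewrite ltr0n; near: n; exists 1%N.
  rewrite floorN normrM [X in _ * X <= _ -> _]ger0_norm ?powR_ge0// powRN.
  by rewrite ler_pdivrMr ?powR_gt0// [X in _ -> _ <= _ * X]ger0_norm ?powR_ge0.
Unshelve. all: by end_near. Qed.
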